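(* Let $0<\kappa,\varepsilon<1$. Let $\phi_{out}\le\frac{a\,\varepsilon\kappa^4\phi_{in}^2}{k^3\log n}$ for a sufficiently small absolute constant $a>0$. Let $G$ be a $d$-bounded $n$-vertex graph with a partition $C_1,\dots,C_h$ of $V$, $h\le k$, such that $\phi_G(C_i)\le\phi_{out}$ for all $i\le h$. For each $i\le h$ let $D_i\subseteq C_i$ satisfy $\phi(G[D_i])\ge\phi_{in}$, and let $B_i=C_i\setminus D_i$. If $\sum_i|B_i|\le\varepsilon n$, then for any $D_j$ with $|D_j|\ge3\sqrt{\varepsilon}\,n$ there exists $\widehat D_j\subseteq D_j$ with $|\widehat D_j|\ge(1-4\sqrt{\varepsilon})|D_j|$ such that for every $s\in\widehat D_j$ and $t=\frac{120\log n}{\kappa\phi_{in}^2}$, $$\|\tilde{\mathbf p}_s^{t}-\mathbf u_{C_j}\|_{TV}<\kappa+\sqrt{\varepsilon}.$$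
   Context: $G=(V,E)$ has maximum degree at most $d$. For $S\subseteq V$, $\phi_G(S)=\frac{|E(S,V\setminus S)|}{d|S|}$ where $E(S,T)$ is the set of edges between $S$ and $T$; $\phi(H)=\min_{S:|S|\le|V(H)|/2}\phi_H(S)$ (with the same $d$; the single-vertex graph has $\phi=1$); $G[S]$ is the induced subgraph. The (normal, lazy) random walk: from vertex $v$ of degree $d_v$, move to each neighbor with probability $\frac{1}{2d}$ and stay at $v$ with probability $1-\frac{d_v}{2d}$. The uniform averaging walk of $t$ steps picks $\ell\in\{0,1,\dots,t-1\}$ uniformly at random and stops the random walk after $\ell$ steps; $\tilde{\mathbf p}_s^t$ is its distribution from start vertex $s$. $\mathbf u_C$ is the uniform distribution on $C$, and $\|\cdot\|_{TV}$ is total variation distance. *)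

(* Defs.v *)
From mathcomp Require Import all_boot all_order all_algebra.
From mathcomp Require Import reals exp.
Import Order.TTheory GRing.Theory Num.Theory.

Set Implicit Arguments.
Unset Strict Implicit.
Unset Printing Implicit Defensive.

Local Open Scope ring_scope.

Record sgraph := SGraph {
  vertex :> finType;
  edge : rel vertex;
  edge_sym : symmetric edge;
  edge_irr : irreflexive edge }.

Arguments edge {G} x y : rename.

Definition degree (G : sgraph) (v : G) : nat := #|[set w | edge v w]|.

Definition bounded_degree (G : sgraph) (d : nat) : Prop :=
  forall v : G, (degree v <= d)%N.

Section Induced.
Variables (G : sgraph) (S : {set G}).

Definition induced_edge : rel {x : G | x \in S} :=
  fun x y => edge (val x) (val y).

Lemma induced_edge_sym : symmetric induced_edge.
Proof. by move=> x y; apply: edge_sym. Qed.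

Lemma induced_edge_irr : irreflexive induced_edge.
Proof. by move=> x; apply: edge_irr. Qed.

Definition induced : sgraph := SGraph induced_edge_sym induced_edge_irr.
End Induced.

(* An edge is the unordered pair of its endpoints. *)
Definition edges_between (G : sgraph) (S T : {set G}) : {set {set G}} :=
  [set [set x; y] | x in S, y in T & edge x y].

Definition set_conductance (R : realType) (G : sgraph) (d : nat)
    (S : {set G}) : R :=
  #|edges_between S (~: S)|%:R / (d%:R * #|S|%:R).

(* The minimum ranges over nonempty S with |S| <= |V(H)|/2. The default 1 is
   the value for a single vertex (and for the empty graph), where there is no
   such S; otherwise it does not affect the minimum, because every S has
   set_conductance at most 1 when degrees are at most d. *)
Definition conductance (R : realType) (H : sgraph) (d : nat) : R :=
  \big[Num.min/1]_(S : {set H} | (S != set0) && (2 * #|S| <= #|H|)%N)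
     set_conductance R d S.

(* The parts are nonempty ([partition]) and distinct indices give distinct
   parts ([injective]). *)
Definition is_ordered_partition (T : finType) (h : nat) (C : 'I_h -> {set T}) :
    Prop :=
  injective C /\ partition [set C i | i : 'I_h] [set: T].

Section Walk.
Variables (R : realType) (G : sgraph) (d : nat).

Definition walk_prob (u v : G) : R :=
  if u == v then 1 - (degree u)%:R / (2 * d%:R)
  else if edge u v then 1 / (2 * d%:R) else 0.

Fixpoint walk_dist (s : G) (l : nat) : G -> R :=
  match l with
  | 0 => fun v => (v == s)%:R
  | l'.+1 => fun v => \sum_(u : G) walk_dist s l' u * walk_prob u v
  end.

Definition avg_walk_dist (s : G) (t : nat) : G -> R :=
  fun v => t%:R^-1 * \sum_(l < t) walk_dist s l v.
End Walk.

Definition unif_dist (R : realType) (T : finType) (C : {set T}) : T -> R :=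
  fun v => (v \in C)%:R / #|C|%:R.

Definition tv_dist (R : realType) (T : finType) (p q : T -> R) : R :=
  2^-1 * \sum_(v : T) `|p v - q v|.

(* Main.v *)
(** Let [C] be the cluster, [D] its expanding core and [W] the walk kernel.
    If [w - push P w = 1_s - x] for a kernel [P] close to [W], then averaging
    along [W] over [t] steps telescopes, and the averaged walk from [s] is within
    [2 |w|_1 / t], up to the leakage of [w] under [W - P], of the averaged walk
    from [x].  So it suffices to find [w] with [|w|_1 < kappa * t] and [x] nearly
    uniform on [D].

    Take for [P] the walk confined to [C], let [x] be its law at the [l]-th visit
    to [D] and [w] its expected occupation measure until then, minus the
    occupation of the uniform start.  The chain watched on [D] is doubly
    stochastic and dominates the walk on [G[D]], hence by Cheeger's inequality it
    contracts mean-zero functions at rate [1 - phi^2/10]; past [O(log n / phi^2)]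
    visits the centered occupation is a convergent geometric tail, so [l] is
    free.  Summed over all starts [s] in [D], the occupation of every vertex of
    [C] is exactly the number of visits: by Markov's inequality most [s] spend
    little time in [C :\: D] and leak little out of [C]. *)

Require Import Defs.
From mathcomp Require Import all_boot all_order all_algebra.
From mathcomp Require Import reals exp.
From mathcomp Require Import sequences ring lra zify.
Import Order.TTheory GRing.Theory Num.Theory.

Set Implicit Arguments.
Unset Strict Implicit.
Unset Printing Implicit Defensive.

Local Open Scope ring_scope.

Lemma sum_indicator (R : realType) (T : finType) (S : {set T}) :
  \sum_x (x \in S)%:R = #|S|%:R :> R.
Proof.
by rewrite -natr_sum -sum1_card [in RHS]big_mkcond.
Qed.

(** * Cheeger's inequality for a symmetric relation with row sums at most [d] *)

Section Cheeger.
Variables (R : realType) (T : finType) (e : rel T).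
Hypothesis e_sym : symmetric e.
Variables (d : nat) (phi : R).
Hypothesis phi_gt0 : 0 < phi.
Hypothesis e_deg : forall x, \sum_y (e x y)%:R <= d%:R :> R.
Hypothesis e_expand : forall S : {set T}, (2 * #|S| <= #|T|)%N ->
  phi * d%:R * #|S|%:R <= \sum_(x in S) \sum_(y in ~: S) (e x y)%:R.

(** The double sum meets every boundary pair in both orders, whence the factor 2. *)
Lemma expand_indicator (S : {set T}) : (2 * #|S| <= #|T|)%N ->
  2 * phi * d%:R * #|S|%:R <=
  \sum_x \sum_y (e x y)%:R * `|(x \in S)%:R - (y \in S)%:R|.
Proof.
move=> /e_expand hS.
rewrite (bigID (mem S)) /=.
rewrite (_ : 2 * phi * d%:R * #|S|%:R = phi * d%:R * #|S|%:R + phi * d%:R *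
  #|S|%:R); last by ring.
apply: lerD; apply: (le_trans hS).
  apply: ler_sum => x xS.
  rewrite [leRHS](bigID (mem S)) /= ler_wpDl ?sumr_ge0 // ?le_eqVlt.
    by move=> y _; rewrite mulr_ge0.
  apply/orP; left; apply/eqP.
  apply: eq_big => [y|y]; rewrite ?inE // xS => /negbTE ->.
  by rewrite subr0 normr1 mulr1.
rewrite exchange_big /= (eq_bigl (fun x => x \notin S)); last by move=> x;
  rewrite inE.
apply: ler_sum => x xS.
rewrite [leRHS](bigID (mem S)) /= ler_wpDr ?sumr_ge0 //.
  by move=> y _; rewrite mulr_ge0.
apply: ler_sum => y yS.
by rewrite e_sym yS (negbTE xS) sub0r normrN normr1 mulr1.
Qed.

(** The layer-cake argument as an induction on the support size: the lowest positive level of [h] is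
    peeled off as a multiple of the indicator of its support, to which [expand_indicator]
    applies. *)
Lemma coarea (h : T -> R) : (forall x, 0 <= h x) ->
  (2 * #|[set x | (0 < h x)%R]| <= #|T|)%N ->
  2 * phi * d%:R * \sum_x h x <= \sum_x \sum_y (e x y)%:R * `|h x - h y|.
Proof.
have [m] : exists m, (#|[set x | (0 < h x)%R]| <= m)%N by exists #|[set x | (0 <
  h x)%R]|.
elim: m h => [|m IH] h hm h0 hs.
  have h_eq0 x : h x = 0.
    apply/eqP; move: hm; rewrite leqn0 cards_eq0 => /eqP /setP /(_ x).
    by rewrite !inE lt_neqAle h0 andbT => /negbT; rewrite negbK eq_sym.
  rewrite big1 // mulr0 sumr_ge0 // => x _; rewrite sumr_ge0 // => y _.
  by rewrite mulr_ge0.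
set S := [set x | (0 < h x)%R] in hm hs *.
have [S0|[x0 x0S]] := set_0Vmem S.
  have c0 : (#|S| <= m)%N by rewrite S0 cards0.
  exact: (IH h c0 h0 hs).
have [x1 x1S' x1min] := @arg_minP _ _ _ x0 (mem S) h x0S.
have x1S : x1 \in S := x1S'.
set mu := h x1 in x1min.
have mu0 : 0 < mu by move: x1S; rewrite inE.
pose h' x := h x - mu * (x \in S)%:R.
have hE x : h x = h' x + mu * (x \in S)%:R by rewrite subrK.
have hN x : x \notin S -> h x = 0.
  by rewrite inE lt_neqAle h0 andbT negbK eq_sym => /eqP.
have h'0 x : 0 <= h' x.
  rewrite /h'; case: (boolP (x \in S)) => xS; last by rewrite mulr0 subr0.
  by rewrite mulr1 subr_ge0; apply: x1min.
have S'S : [set x | (0 < h' x)%R] \subset S :\ x1.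
  apply/subsetP => x; rewrite !inE /h' => hx; apply/andP; split.
    by apply: contraTneq hx => ->; rewrite x1S mulr1 subrr ltxx.
  move: hx; case: (boolP (x \in S)) => [|xS]; first by rewrite inE.
  by rewrite mulr0 subr0.
have S'c : (#|[set x | (0 < h' x)%R]| < #|S|)%N.
  by apply: leq_ltn_trans (subset_leq_card S'S) _; rewrite (cardsD1 x1 S) x1S.
have IH' := IH h' (leq_trans S'c hm) h'0 (leq_trans (leq_mul (leqnn 2) (ltnW
  S'c)) hs).
have -> : \sum_x h x = \sum_x h' x + mu * #|S|%:R.
  rewrite (eq_bigr _ (fun x _ => hE x)) big_split /= -mulr_sumr; congr (_ + _ * _).
  exact: sum_indicator.
(* The absolute values add exactly: [h'] is nonnegative and vanishes off [S], so its differences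
   never have the sign opposite to those of the indicator. *)
have -> : \sum_x \sum_y (e x y)%:R * `|h x - h y| =
   \sum_x \sum_y (e x y)%:R * `|h' x - h' y| +
   mu * \sum_x \sum_y (e x y)%:R * `|(x \in S)%:R - (y \in S)%:R|.
  rewrite mulr_sumr -big_split /=; apply: eq_bigr => x _.
  rewrite mulr_sumr -big_split /=; apply: eq_bigr => y _.
  rewrite mulrCA -mulrDr; congr (_ * _).
  have := h'0 x; have := h'0 y; have := hE x; have := hE y.
  rewrite /h'; case: (boolP (x \in S)) => xS; case: (boolP (y \in S)) => yS;
    rewrite ?mulr0 ?mulr1 ?subr0 ?addr0 ?subrr ?sub0r ?normr0 ?mulr0 ?addr0 => _
      _ h1 h2 //.
  - by congr `|_|; ring.
  - by rewrite (hN y yS) !subr0 normr1 mulr1 !ger0_norm ?subr_ge0 ?subrK //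
    -subr_ge0.
  - by rewrite (hN x xS) !sub0r !normrN normr1 mulr1 !ger0_norm ?subr_ge0 ?subrK
    // -subr_ge0.
by rewrite mulrDr lerD // mulrCA ler_pM2l // expand_indicator.
Qed.

(** [coarea] is used for the squares of [g]. AM-GM with weight [phi] replaces Cauchy-Schwarz, and
    half of the resulting lower bound absorbs the degree terms. *)
Lemma cheeger_half (g : T -> R) : (forall x, 0 <= g x) ->
  (2 * #|[set x | (0 < g x)%R]| <= #|T|)%N ->
  phi ^+ 2 * d%:R * \sum_x g x ^+ 2 <= \sum_x \sum_y (e x y)%:R * (g x - g y) ^+ 2.
Proof.
move=> g0 gs.
have := @coarea (fun x => g x ^+ 2) (fun x => sqr_ge0 _).
have -> : [set x | 0 < g x ^+ 2] = [set x | (0 < g x)%R].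
  by apply/setP => x; rewrite !inE exprn_even_gt0 //= lt0r g0 andbT.
move=> /(_ gs) hco.
set N := \sum_x g x ^+ 2 in hco *; set EE := \sum_x \sum_y _ * (_ - _) ^+ 2.
have deg1 : \sum_x \sum_y (e x y)%:R * g x ^+ 2 <= d%:R * N.
  rewrite mulr_sumr; apply: ler_sum => x _; rewrite -mulr_suml.
  by rewrite ler_wpM2r ?sqr_ge0.
have deg2 : \sum_x \sum_y (e x y)%:R * g y ^+ 2 <= d%:R * N.
  rewrite exchange_big /= mulr_sumr; apply: ler_sum => x _; rewrite -mulr_suml.
  by rewrite ler_wpM2r ?sqr_ge0 // (eq_bigr (fun y => (e x y)%:R)) // => y _;
    rewrite e_sym.
(* Termwise, with [a = g x - g y] and [b = g x + g y], this is [4 * phi * |a * b| <= 4 * a ^+ 2 +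
   phi ^+ 2 * b ^+ 2] together with [b ^+ 2 <= 2 * (g x ^+ 2 + g y ^+ 2)]. *)
have ham : 2 * phi * \sum_x \sum_y (e x y)%:R * `|g x ^+ 2 - g y ^+ 2| <=
    2 * EE + phi ^+ 2 * (\sum_x \sum_y (e x y)%:R * g x ^+ 2 + \sum_x \sum_y (e x
      y)%:R * g y ^+ 2).
  rewrite /EE mulrDr !mulr_sumr -!big_split /=; apply: ler_sum => x _.
  rewrite !mulr_sumr -!big_split /=; apply: ler_sum => y _.
  case: (e x y); rewrite ?(mul0r, mulr0, addr0) // !mul1r.
  have : 0 <= (2 * (g x - g y) - phi * (g x + g y)) ^+ 2 by apply: sqr_ge0.
  have : 0 <= (2 * (g x - g y) + phi * (g x + g y)) ^+ 2 by apply: sqr_ge0.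
  have : 0 <= phi ^+ 2 * (g x - g y) ^+ 2 by rewrite mulr_ge0 ?sqr_ge0.
  move=> h1 h2 h3.
  case: (ger0P (g x ^+ 2 - g y ^+ 2)) => _; nra.
have h2 : phi * (2 * phi * d%:R * N) <= phi * \sum_x \sum_y (e x y)%:R * `|g x ^+
  2 - g y ^+ 2|.
  by rewrite ler_pM2l.
have h3 := ler_wpM2l (sqr_ge0 phi) (lerD deg1 deg2).
nra.
Qed.

Lemma median (f : T -> R) : (0 < #|T|)%N -> exists c,
  (2 * #|[set x | (c < f x)%R]| <= #|T|)%N /\ (2 * #|[set x | (f x < c)%R]| <=
    #|T|)%N.
Proof.
move=> /card_gt0P[z0 _].
pose A := [pred x | (2 * #|[set y | (f x < f y)%R]| <= #|T|)%N].
have [z _ zmax] := @arg_maxP _ _ _ z0 predT f isT.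
have zA : A z.
  rewrite /A /= (_ : [set y | _] = set0) ?cards0 //.
  by apply/setP => y; rewrite !inE ltNge; have := zmax y isT => /= ->.
(* The median is the least value with at most half of the points strictly above it: were more than
   half strictly below, the largest value below it would qualify too. *)
have [x xA xmin] := @arg_minP _ _ _ z A f zA.
exists (f x); split => //; rewrite leqNgt; apply/negP => hL.
set L := [set y | f y < f x] in hL.
have [L0|[y0 y0L]] := set_0Vmem L; first by rewrite L0 cards0 in hL.
have [y yL' ymax] := @arg_maxP _ _ _ y0 (mem L) f y0L.
have yL : y \in L := yL'.
have /xmin : A y.
  have : [set u | f y < f u] \subset ~: L.
    apply/subsetP => u; rewrite !inE => yu; apply/negP => uL.
    have uL' : u \in L by rewrite inE.
    have /= := ymax u uL'.
    by rewrite leNgt yu.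
  have half a b c m : (m < 2 * b -> b + c = m -> a <= c -> 2 * a <= m)%N by lia.
  by move=> /subset_leq_card; apply: half hL (cardsC L).
by move: yL; rewrite inE => hy; rewrite leNgt hy.
Qed.

(** The positive and negative parts of [f - c], for a median [c], each have support at most half of
    [T], so [cheeger_half] applies to both. *)
Lemma cheeger (f : T -> R) : \sum_x f x = 0 ->
  phi ^+ 2 * d%:R * \sum_x f x ^+ 2 <= \sum_x \sum_y (e x y)%:R * (f x - f y) ^+ 2.
Proof.
move=> f0; have [T0|/(median f)[c [cp cn]]] := posnP #|T|.
  rewrite [X in _ * X]big1 ?mulr0; last by move=> x; have := fintype0 x T0.
  by rewrite big1 // => x; have := fintype0 x T0.
pose g x := Num.max (f x - c) 0; pose g' x := Num.max (c - f x) 0.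
have g0 x : 0 <= g x by rewrite /g le_max lexx orbT.
have g'0 x : 0 <= g' x by rewrite /g' le_max lexx orbT.
have h1 : phi ^+ 2 * d%:R * \sum_x g x ^+ 2 <= \sum_x \sum_y (e x y)%:R * (g x -
  g y) ^+ 2.
  apply: cheeger_half => //; rewrite (_ : [set x | _] = [set x | c < f x]) //.
  by apply/setP => x; rewrite !inE /g lt_max ltxx orbF subr_gt0.
have h2 : phi ^+ 2 * d%:R * \sum_x g' x ^+ 2 <= \sum_x \sum_y (e x y)%:R * (g' x
  - g' y) ^+ 2.
  apply: cheeger_half => //; rewrite (_ : [set x | _] = [set x | (f x < c)%R]) //.
  by apply/setP => x; rewrite !inE /g' lt_max ltxx orbF subr_gt0.
(* As [f] sums to zero, recentering at [c] can only increase the sum of squares. *)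
have h3 : \sum_x f x ^+ 2 <= \sum_x g x ^+ 2 + \sum_x g' x ^+ 2.
  rewrite -big_split /=.
  have -> : \sum_x (g x ^+ 2 + g' x ^+ 2) = \sum_x (f x ^+ 2 + (c ^+ 2 - 2 * c *
    f x)).
    apply: eq_bigr => x _; rewrite /g /g'.
    case: (lerP (f x - c) 0) => ?; case: (lerP (c - f x) 0) => ?; nra.
  rewrite big_split /= lerDl sumrB.
  have -> : \sum_x 2 * c * f x = 0 by rewrite -mulr_sumr f0 mulr0.
  rewrite subr0.
  by rewrite sumr_ge0 // => x _; apply: sqr_ge0.
apply: (@le_trans _ _ (phi ^+ 2 * d%:R * (\sum_x g x ^+ 2 + \sum_x g' x ^+ 2))).
  by rewrite ler_wpM2l // mulr_ge0 // sqr_ge0.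
rewrite mulrDr; apply: (le_trans (lerD h1 h2)).
(* The increments of [g] and [g'] have product at most zero and difference [f x - f y], so their
   squares add up to at most its square. *)
rewrite -big_split /=; apply: ler_sum => x _.
rewrite -big_split /=; apply: ler_sum => y _.
rewrite -mulrDr ler_wpM2l //.
rewrite /g /g'.
case: (lerP (f x - c) 0) => ?; case: (lerP (c - f x) 0) => ?;
case: (lerP (f y - c) 0) => ?; case: (lerP (c - f y) 0) => ?; nra.
Qed.

End Cheeger.

(** * Kernels on a finite type: excursions and L2 dissipation *)

Section Kernels.
Variables (R : realType) (T : finType).
Implicit Types (K P Q : T -> T -> R) (x y f : T -> R).

(** Kernels act on the right of row vectors, so [push K] advances laws rather than test
    functions. *)
Definition push K x : T -> R := fun v => \sum_u x u * K u v.

Definition l1norm x : R := \sum_v `|x v|.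

Lemma l1norm_push K (m : T -> R) x : (forall u, \sum_v `|K u v| <= m u) ->
  l1norm (push K x) <= \sum_u `|x u| * m u.
Proof.
move=> hm; apply: (@le_trans _ _ (\sum_v \sum_u `|x u| * `|K u v|)).
  apply: ler_sum => v _; apply: le_trans (ler_norm_sum _ _ _) _.
  by apply: ler_sum => u _; rewrite normrM.
rewrite exchange_big /=; apply: ler_sum => u _.
by rewrite -mulr_sumr ler_wpM2l.
Qed.

(** The hypothesis says that [1 - Q] has trivial left kernel; in finite dimension it is then
    invertible and [H = P (1 - Q)^-1], with no series to sum. *)
Lemma kernel_eq_solvable P Q :
  (forall y, (forall v, y v = push Q y v) -> forall v, y v = 0) ->
  exists H, forall u v, H u v = P u v + push Q (H u) v.
Proof.
move=> inj.
pose mx K : 'M[R]_#|T| := \matrix_(i, j) K (enum_val i) (enum_val j).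
have Au : 1%:M - mx Q \in unitmx.
  rewrite -row_free_unit -kermx_eq0; apply/eqP/row_matrixP => i; rewrite row0.
  set z := row i _.
  have hz : z = z *m mx Q.
    apply/eqP; rewrite -subr_eq0 -{1}[z]mulmx1 -mulmxBr /z -row_mul mulmx_ker.
    by rewrite row0.
  have hy : forall v, z 0 (enum_rank v) = 0.
    apply: (inj (fun v => z 0 (enum_rank v))) => v.
    rewrite {1}hz mxE /push (reindex enum_rank) /=; last
      exact/onW_bij/enum_rank_bij.
    by apply: eq_bigr => u _; rewrite [mx Q _ _]mxE !enum_rankK.
  by apply/rowP => j; rewrite -[j]enum_valK hy mxE.
pose M := mx P *m invmx (1%:M - mx Q).
have hM : M = mx P + M *m mx Q.
  by apply/eqP; rewrite -subr_eq -{1}[M]mulmx1 -mulmxBr mulmxKV.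
exists (fun u v => M (enum_rank u) (enum_rank v)) => u v.
rewrite {1}hM !mxE !enum_rankK; congr (_ + _).
rewrite /push (reindex enum_rank) /=; last exact/onW_bij/enum_rank_bij.
by apply: eq_bigr => w _; rewrite [mx Q _ _]mxE !enum_rankK.
Qed.

Section Excursions.
Variables (P : T -> T -> R) (B : {set T}) (gamma : R).
Hypothesis P_ge0 : forall u v, 0 <= P u v.
Hypothesis gamma_gt0 : 0 < gamma.
Hypothesis B_escape : forall b, b \in B -> \sum_(v in B) P b v <= 1 - gamma.

(** The negative part [m] of [y] is a subsolution; its sum over [B] is at most [1 - gamma] times
    itself, so [m] vanishes on [B] and then everywhere. *)
Lemma minimum_principle y :
  (forall v, \sum_(b in B) y b * P b v <= y v) -> forall v, 0 <= y v.
Proof.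
move=> hy.
pose m v := Num.max (- y v) 0.
have m0 v : 0 <= m v by rewrite /m le_max lexx orbT.
have hm v : m v <= \sum_(b in B) m b * P b v.
  rewrite {1}/m ge_max; apply/andP; split; last by rewrite sumr_ge0 // => b _;
    rewrite mulr_ge0.
  rewrite lerNl; apply: le_trans (hy v); rewrite -sumrN; apply: ler_sum => b _.
  by rewrite -mulNr ler_wpM2r // lerNl /m le_max lexx.
have hB : \sum_(b in B) m b = 0.
  apply/eqP; rewrite eq_le sumr_ge0 // andbT.
  have : \sum_(v in B) m v <= (1 - gamma) * \sum_(b in B) m b.
    apply: (@le_trans _ _ (\sum_(v in B) \sum_(b in B) m b * P b v)); first
      exact: ler_sum.
    rewrite exchange_big mulr_sumr; apply: ler_sum => b bB.
    by rewrite -mulr_sumr mulrC ler_wpM2r // B_escape.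
  have := gamma_gt0; nra.
have mB b : b \in B -> m b = 0.
  move=> bB; move/eqP: hB; rewrite psumr_eq0 // => /allP /(_ b).
  by rewrite mem_index_enum bB /= => /(_ isT)/eqP.
move=> v; have := hm v; rewrite big1 => [|b bB]; last by rewrite mB ?mul0r.
by rewrite /m ge_max lerNl oppr0 => /andP[].
Qed.

Lemma excursion_unique y : (forall v, y v = \sum_(b in B) y b * P b v) ->
  forall v, y v = 0.
Proof.
move=> hy v; apply/eqP; rewrite eq_le.
rewrite (minimum_principle (y := y)) ?andbT => [|w]; last by rewrite -hy.
rewrite -oppr_ge0 (minimum_principle (y := fun v => - y v)) // => w.
by rewrite [in leRHS]hy -sumrN; apply: ler_sum => b _; rewrite mulNr.
Qed.

(** Uniqueness for the homogeneous equation yields a solution, and the minimum principle applied to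
    each row makes it nonnegative. *)
Lemma excursion_kernel : exists2 H : T -> T -> R,
  (forall u v, 0 <= H u v) &
  (forall u v, H u v = P u v + \sum_(b in B) H u b * P b v).
Proof.
pose Q b v := (b \in B)%:R * P b v.
have pushQ y v : push Q y v = \sum_(b in B) y b * P b v.
  rewrite [RHS]big_mkcond; apply: eq_bigr => b _; rewrite /Q.
  by case: (b \in B); rewrite ?mul1r ?mul0r ?mulr0.
have [|H hH] := @kernel_eq_solvable P Q.
  by move=> y hy; apply: excursion_unique => v; rewrite -pushQ.
exists H => u v; last by rewrite -pushQ.
apply: (minimum_principle (y := H u)) => w.
by rewrite [leRHS]hH pushQ lerDr.
Qed.

End Excursions.

(** Recentering at [f v] keeps the variance and kills the term [u = v]; Cauchy-Schwarz over the
    other points, of total weight [1 - a v], then gains the factor [a v]. *)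
Lemma weighted_variance_ge (a f : T -> R) v :
  (forall u, 0 <= a u) -> \sum_u a u = 1 ->
  a v * \sum_u a u * (f u - f v) ^+ 2 <=
  \sum_u a u * f u ^+ 2 - (\sum_u a u * f u) ^+ 2.
Proof.
move=> a0 a1.
have aC c : c = \sum_u a u * c by rewrite -mulr_suml a1 mul1r.
set G2 := \sum_u a u * (f u - f v) ^+ 2.
set G1 := \sum_u a u * (f u - f v).
have hG2 : G2 = \sum_u a u * f u ^+ 2 - 2 * f v * \sum_u a u * f u + f v ^+ 2.
  rewrite [X in _ = _ + X]aC mulr_sumr -sumrB -big_split /=.
  by apply: eq_bigr => u _; ring.
have hG1 : G1 = \sum_u a u * f u - f v.
  rewrite [X in _ = _ - X]aC -sumrB.
  by apply: eq_bigr => u _; ring.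
have -> : \sum_u a u * f u ^+ 2 - (\sum_u a u * f u) ^+ 2 = G2 - G1 ^+ 2.
  by rewrite hG2 hG1; ring.
(* Cauchy-Schwarz in discriminant form: the sum of squares over [u != v] is nonnegative for every
   shift [mu]. *)
have quad mu : 0 <= G2 - 2 * mu * G1 + (1 - a v) * mu ^+ 2.
  have -> : G2 - 2 * mu * G1 + (1 - a v) * mu ^+ 2 =
     \sum_u a u * (f u - f v - mu) ^+ 2 - a v * (f v - f v - mu) ^+ 2.
    have -> : \sum_u a u * (f u - f v - mu) ^+ 2 = G2 - 2 * mu * G1 + mu ^+ 2.
      rewrite [X in _ = _ + X]aC mulr_sumr -sumrB -big_split /=.
      by apply: eq_bigr => u _; ring.
    by ring.
  rewrite subr_ge0 (bigD1 v) //= lerDl sumr_ge0 // => u _.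
  by rewrite mulr_ge0 ?sqr_ge0.
have av1 : a v <= 1 by rewrite -a1 (bigD1 v) //= lerDl sumr_ge0.
have [A0|A0] := eqVneq (a v) 1.
  rewrite A0 mul1r; have [->|g0] := eqVneq G1 0; first by rewrite expr0n /= subr0.
  (* For [a v = 1] the quadratic degenerates to a linear function of [mu]; this [mu] would make it
     [-1], so [G1] must vanish. *)
  have := quad ((G2 + 1) / (2 * G1)).
  have -> : G2 - 2 * ((G2 + 1) / (2 * G1)) * G1 + (1 - a v) * ((G2 + 1) / (2 *
    G1)) ^+ 2 = - 1.
    by rewrite A0; field.
  by rewrite oppr_ge0 ler10.
have A1 : 0 < 1 - a v by rewrite subr_gt0 lt_neqAle A0.
have := quad (G1 / (1 - a v)).
have -> : G2 - 2 * (G1 / (1 - a v)) * G1 + (1 - a v) * (G1 / (1 - a v)) ^+ 2 =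
   (G2 - G1 ^+ 2 - a v * G2) / (1 - a v).
  by field; rewrite gt_eqF.
by rewrite pmulr_lge0 ?invr_gt0 // subr_ge0.
Qed.

(** [push K f v] is the mean of [f] under the column weights [K u v], so [weighted_variance_ge]
    applies at each [v], the holding probability [K v v] turning variance into a Dirichlet form. The
    row sums turn the averaged second moments into the norm of [f]. *)
Lemma l2_dissipation (D : {set T}) (K : T -> T -> R) f :
  (forall u v, 0 <= K u v) ->
  (forall u v, v \notin D -> K u v = 0) ->
  (forall u, u \in D -> \sum_v K u v = 1) ->
  (forall v, v \in D -> \sum_u K u v = 1) ->
  (forall v, v \notin D -> f v = 0) ->
  \sum_(v in D) K v v * \sum_u K u v * (f u - f v) ^+ 2 <=
  \sum_v f v ^+ 2 - \sum_v push K f v ^+ 2.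
Proof.
move=> K0 Kout Krow Kcol fout.
have -> : \sum_v f v ^+ 2 = \sum_(v in D) \sum_u K u v * f u ^+ 2.
  have -> : \sum_(v in D) \sum_u K u v * f u ^+ 2 = \sum_v \sum_u K u v * f u ^+ 2.
    rewrite [LHS]big_mkcond; apply: eq_bigr => v _; case: ifPn => // vD.
    by rewrite big1 // => u _; rewrite Kout ?mul0r.
  rewrite exchange_big /=; apply: eq_bigr => u _; rewrite -mulr_suml.
  have [uD|uD] := boolP (u \in D); first by rewrite Krow ?mul1r.
  by rewrite fout // expr0n mulr0.
have -> : \sum_v push K f v ^+ 2 = \sum_(v in D) push K f v ^+ 2.
  rewrite [RHS]big_mkcond; apply: eq_bigr => v _; case: ifPn => // vD.
  by rewrite /push big1 ?expr0n // => u _; rewrite Kout ?mulr0.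
rewrite -sumrB; apply: ler_sum => v vD.
have := @weighted_variance_ge (fun u => K u v) f v (fun u => K0 u v) (Kcol v vD).
rewrite (_ : push K f v = \sum_u K u v * f u) //.
by apply: eq_bigr => u _; rewrite mulrC.
Qed.

End Kernels.

(** * The chain watched on the core and its occupation measures *)

Section Trace.
Variables (R : realType) (T : finType) (C D : {set T}).
Variables (P H : T -> T -> R) (gamma : R).
Let B := C :\: D.
Hypothesis D_sub_C : D \subset C.
Hypothesis P_ge0 : forall u v, 0 <= P u v.
Hypothesis P_outl : forall u v, u \notin C -> P u v = 0.
Hypothesis P_outr : forall u v, v \notin C -> P u v = 0.
Hypothesis P_row : forall u, u \in C -> \sum_v P u v = 1.
Hypothesis P_col : forall v, v \in C -> \sum_u P u v = 1.
Hypothesis gamma_gt0 : 0 < gamma.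
Hypothesis B_escape : forall b, b \in B -> \sum_(v in B) P b v <= 1 - gamma.
Hypothesis H_ge0 : forall u v, 0 <= H u v.
(* [H u v] is the expected number of visits to [v] after time 0, up to and
   including the first step in [D], for the chain [P] started at [u]. *)
Hypothesis H_eq : forall u v, H u v = P u v + \sum_(b in B) H u b * P b v.

Lemma excursion_outr u v : v \notin C -> H u v = 0.
Proof.
by move=> vC; rewrite H_eq P_outr // add0r big1 // => b _; rewrite P_outr ?mulr0.
Qed.

Lemma kernel_le_excursion u v : P u v <= H u v.
Proof. by rewrite H_eq lerDl sumr_ge0 // => b _; rewrite mulr_ge0. Qed.

Lemma sum_core_rest (F : T -> R) : (forall v, v \notin C -> F v = 0) ->
  \sum_v F v = \sum_(v in D) F v + \sum_(v in B) F v.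
Proof.
move=> F0; rewrite (bigID (mem D)) /=; congr (_ + _).
rewrite big_mkcond [RHS]big_mkcond /=; apply: eq_bigr => v _; rewrite inE.
by case: (v \in D) => //=; case: ifPn => // vC; rewrite F0.
Qed.

Lemma rest_sub_cluster b : b \in B -> b \in C.
Proof. by rewrite inE => /andP[]. Qed.

(** Summing [H_eq] over all [v] gives 1 plus the total of [H u] over [B]; that total cancels and the
    part on [D] remains. *)
Lemma excursion_row u : u \in C -> \sum_(v in D) H u v = 1.
Proof.
move=> uC; have := sum_core_rest (fun v => @excursion_outr u v).
rewrite (eq_bigr _ (fun v _ => H_eq u v)) big_split /= P_row // exchange_big /=.
have -> : \sum_(b in B) \sum_v H u b * P b v = \sum_(b in B) H u b.
  by apply: eq_bigr => b bB; rewrite -mulr_sumr P_row ?mulr1 // rest_sub_cluster.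
by move/addIr.
Qed.

(** A Kac-type identity: by the column sums of [P], the difference with the indicator of [C] solves
    the homogeneous excursion equation, hence is zero. *)
Lemma excursion_col v : v \in C -> \sum_(u in D) H u v = 1.
Proof.
move=> vC.
pose y v := \sum_(u in D) H u v - (v \in C)%:R.
suff: y v = 0 by rewrite /y vC => /eqP; rewrite subr_eq0 => /eqP.
apply: (excursion_unique P_ge0 gamma_gt0 B_escape) => {}v {vC}.
have -> : \sum_(b in B) y b * P b v =
    \sum_(u in D) \sum_(b in B) H u b * P b v - \sum_(b in B) P b v.
  rewrite exchange_big /= -sumrB; apply: eq_bigr => b bB.
  by rewrite /y rest_sub_cluster // mulrBl mul1r -mulr_suml.
have -> : (\sum_(u in D) \sum_(b in B) H u b * P b v) =
   \sum_(u in D) H u v - \sum_(u in D) P u v.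
  by rewrite -sumrB; apply: eq_bigr => u _; rewrite [H u v]H_eq addrAC subrr add0r.
rewrite /y -addrA -opprD; congr (_ - _).
rewrite -(sum_core_rest (F := fun u => P u v)); last by move=> u uC; apply: P_outl.
have [vC|vC] := boolP (v \in C); first by rewrite P_col.
by rewrite big1 // => u _; apply: P_outr.
Qed.

(** For [u] in [D], the law of the first return to [D]. *)
Definition trace_kernel u v := (u \in D)%:R * ((v \in D)%:R * H u v).
(** Expected visits during one excursion from [u] in [D]: time 0 counts, the return to [D] does
    not. *)
Definition occupation_kernel u v :=
  (u \in D)%:R * ((u == v)%:R + (v \in B)%:R * H u v).
Local Notation S := trace_kernel.
Local Notation E := occupation_kernel.

Lemma trace_ge0 u v : 0 <= S u v. Proof. by rewrite /S !mulr_ge0. Qed.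

Lemma occupation_kernel_ge0 u v : 0 <= E u v.
Proof. by rewrite /E mulr_ge0 // addr_ge0 // mulr_ge0. Qed.

Lemma trace_row u : u \in D -> \sum_v S u v = 1.
Proof.
move=> uD; rewrite -(@excursion_row u) ?(subsetP D_sub_C) // [RHS]big_mkcond /=.
by apply: eq_bigr => v _; rewrite /S uD mul1r; case: (v \in D); rewrite ?mul1r
  ?mul0r.
Qed.

Lemma trace_col v : \sum_u S u v = (v \in D)%:R.
Proof.
have [vD|vD] := boolP (v \in D); last first.
  by rewrite big1 // => u _; rewrite /S (negbTE vD) mul0r mulr0.
rewrite -(@excursion_col v) ?(subsetP D_sub_C) // [RHS]big_mkcond /=.
by apply: eq_bigr => u _; rewrite /S vD mul1r; case: (u \in D); rewrite ?mul1r
  ?mul0r.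
Qed.

Lemma occupation_kernel_col v : \sum_u E u v = (v \in C)%:R.
Proof.
rewrite /E (eq_bigr (fun u => (u \in D)%:R * (u == v)%:R + (v \in B)%:R * ((u \in
  D)%:R * H u v))); last first.
  by move=> u _; rewrite mulrDr mulrCA.
rewrite big_split /= -mulr_sumr.
have -> : \sum_u (u \in D)%:R * (u == v)%:R = (v \in D)%:R :> R.
  rewrite (bigD1 v) //= eqxx mulr1 big1 ?addr0 // => u /negbTE ->.
  by rewrite mulr0.
have -> : \sum_u (u \in D)%:R * H u v = \sum_(u in D) H u v.
  rewrite [RHS]big_mkcond; apply: eq_bigr => u _.
  by case: (u \in D); rewrite ?mul1r ?mul0r.
have [vC|vC] := boolP (v \in C).
  by rewrite excursion_col // mulr1 inE vC andbT; case: (v \in D); rewrite ?addr0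
    ?add0r.
rewrite inE (negbTE vC) andbF mul0r addr0.
by have /contraNF -> := subsetP D_sub_C v.
Qed.

Lemma push_trace_out f v : v \notin D -> push S f v = 0.
Proof.
by move=> /negbTE vD; rewrite /push big1 // => u _; rewrite /S vD mul0r !mulr0.
Qed.

Lemma push_occupation_core f v : (forall u, u \notin D -> f u = 0) -> v \in D ->
  push E f v = f v.
Proof.
move=> f0 vD; rewrite /push (bigD1 v) //= big1 => [|u /negbTE uv].
  by rewrite /E eqxx inE vD /= mul0r !addr0 mul1r mulr1.
by rewrite /E uv inE vD /= mul0r addr0 !mulr0.
Qed.

(** On [D] this is the kernel identity [E - E P = 1 - S]: one more step turns [E] into [H], which
    trades the start of the excursion for its end. *)
Lemma push_occupation_poisson f v : (forall u, u \notin D -> f u = 0) ->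
  push E f v - push P (push E f) v = f v - push S f v.
Proof.
move=> f0.
suff kern u : u \in D -> E u v - \sum_w E u w * P w v = (u == v)%:R - S u v.
  have -> : push P (push E f) v = \sum_u f u * \sum_w E u w * P w v.
    rewrite /push (eq_bigr (fun w => \sum_u f u * (E u w * P w v))).
      by rewrite exchange_big /=; apply: eq_bigr => u _; rewrite mulr_sumr.
    by move=> w _; rewrite mulr_suml; apply: eq_bigr => u _; rewrite mulrA.
  have -> : f v = \sum_u f u * (u == v)%:R.
    by rewrite (bigD1 v) //= eqxx mulr1 big1 ?addr0 // => u /negbTE ->; rewrite
      mulr0.
  rewrite /push -!sumrB; apply: eq_bigr => u _; rewrite -!mulrBr.
  by have [/kern->//|/f0 ->] := boolP (u \in D); rewrite !mul0r.
move=> uD.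
have -> : \sum_w E u w * P w v = H u v.
  rewrite H_eq (eq_bigr (fun w => (u == w)%:R * P w v + (w \in B)%:R * H u w * P
    w v)).
    rewrite big_split /=; congr (_ + _).
      rewrite (bigD1 u) //= eqxx mul1r big1 ?addr0 // => w /negbTE.
      by rewrite eq_sym => ->; rewrite mul0r.
    rewrite [RHS]big_mkcond; apply: eq_bigr => w _.
    by case: (w \in B); rewrite ?mul1r ?mul0r.
  by move=> w _; rewrite /E uD mul1r mulrDl.
rewrite /E /S uD !mul1r -addrA; congr (_ + _).
have [vC|vC] := boolP (v \in C); last by rewrite excursion_outr // !mulr0 subrr
  oppr0.
by rewrite inE vC andbT; case: (v \in D); rewrite ?mul0r ?mul1r ?sub0r ?subrr
  ?oppr0.
Qed.

(** Law of the [j]-th visit to [D], the start [s] being visit 0; [occupation s l] thus stops just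
    before visit [l]. *)
Definition visit_dist s j : T -> R := iter j (push S) (fun v => (v == s)%:R).
Definition occupation s l v := \sum_(j < l) push E (visit_dist s j) v.

Lemma visit_ge0 s j v : 0 <= visit_dist s j v.
Proof.
case: j v => [|j] v; first by [].
elim: j v => [|j IH] v; rewrite /visit_dist iterS /push sumr_ge0 // => u _.
  by rewrite mulr_ge0 ?trace_ge0.
by rewrite mulr_ge0 ?trace_ge0 // IH.
Qed.

Lemma visit_out s j v : s \in D -> v \notin D -> visit_dist s j v = 0.
Proof.
move=> sD vD; case: j => [|j]; last by rewrite /visit_dist iterS push_trace_out.
by rewrite /visit_dist /=; case: eqP => // vs; rewrite vs sD in vD.
Qed.

Lemma visit_mass s j : s \in D -> \sum_v visit_dist s j v = 1.
Proof.
move=> sD; elim: j => [|j IH].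
  by rewrite /visit_dist /= (bigD1 s) //= eqxx big1 ?addr0 // => v /negbTE ->.
rewrite -IH {1}/visit_dist iterS -/(visit_dist s j) /push exchange_big /=.
apply: eq_bigr => u _; rewrite -mulr_sumr.
have [uD|uD] := boolP (u \in D); first by rewrite trace_row ?mulr1.
by rewrite visit_out ?mul0r.
Qed.

Lemma sum_visit j v : \sum_(s in D) visit_dist s j v = (v \in D)%:R.
Proof.
elim: j v => [|j IH] v.
  rewrite /visit_dist /= big_mkcond (bigD1 v) //= eqxx big1 ?addr0.
    by case: (v \in D).
  by move=> s /negbTE sv; rewrite eq_sym sv; case: ifP.
rewrite -trace_col /visit_dist.
under eq_bigr do rewrite iterS -/(visit_dist _ j) /push.
rewrite exchange_big /=; apply: eq_bigr => u _.
rewrite -mulr_suml IH /S; by case: (u \in D); rewrite ?mul1r ?mul0r ?mulr0.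
Qed.

Lemma occupation_ge0 s l v : 0 <= occupation s l v.
Proof.
rewrite /occupation sumr_ge0 // => j _; rewrite /push sumr_ge0 // => u _.
by rewrite mulr_ge0 ?visit_ge0 ?occupation_kernel_ge0.
Qed.

Lemma occupation_kernel_outr u v : v \notin C -> E u v = 0.
Proof.
move=> vC; apply/eqP; rewrite eq_le occupation_kernel_ge0 andbT.
have <- : \sum_w E w v = 0 by rewrite occupation_kernel_col (negbTE vC).
by rewrite (bigD1 u) //= lerDl sumr_ge0 // => w _; apply: occupation_kernel_ge0.
Qed.

Lemma occupation_out s l v : v \notin C -> occupation s l v = 0.
Proof.
move=> vC; rewrite /occupation big1 // => j _; rewrite /push big1 // => u _.
by rewrite occupation_kernel_outr ?mulr0.
Qed.

(** The watched chain preserves the counting measure on [D], and one excursion from that measure has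
    total expected occupation 1 at every vertex of [C]. This exact total feeds Markov's inequality
    when the starts are selected. *)
Lemma sum_occupation l v : \sum_(s in D) occupation s l v = l%:R * (v \in C)%:R.
Proof.
rewrite /occupation exchange_big /= (eq_bigr (fun=> (v \in C)%:R)).
  by rewrite sumr_const card_ord mulr_natl.
move=> j _; rewrite -occupation_kernel_col /push exchange_big /=; apply: eq_bigr
  => u _.
rewrite -mulr_suml sum_visit /E.
by case: (u \in D); rewrite ?mul1r ?mul0r ?mulr0.
Qed.

Lemma occupation_D s l : s \in D -> \sum_(v in D) occupation s l v = l%:R.
Proof.
move=> sD; rewrite /occupation exchange_big /= (eq_bigr (fun=> 1)).
  by rewrite sumr_const card_ord.
move=> j _; rewrite -(visit_mass j sD) [RHS](bigID (mem D)) /=.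
rewrite [X in _ = _ + X]big1 ?addr0; last by move=> v vD; rewrite visit_out.
by apply: eq_bigr => v vD; rewrite push_occupation_core // => u uD; rewrite
  visit_out.
Qed.

(** By [push_occupation_poisson] excursion [j] contributes the difference of the laws of visits [j]
    and [j.+1], and the sum telescopes. *)
Lemma occupation_poisson s l v : s \in D ->
  occupation s l v - push P (occupation s l) v = (v == s)%:R - visit_dist s l v.
Proof.
move=> sD; elim: l => [|l IH].
  rewrite /occupation big_ord0 /visit_dist /= subrr sub0r /push big1 ?oppr0 //.
  by move=> u _; rewrite big_ord0 mul0r.
have rec u : occupation s l.+1 u = occupation s l u + push E (visit_dist s l) u.
  by rewrite /occupation big_ord_recr.
have -> : push P (occupation s l.+1) v =
   push P (occupation s l) v + push P (push E (visit_dist s l)) v.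
  by rewrite /push -big_split /=; apply: eq_bigr => u _; rewrite rec mulrDl.
rewrite rec opprD addrACA IH push_occupation_poisson; last by move=> u uD;
  rewrite visit_out.
by rewrite addrA subrK.
Qed.

Lemma push_kernel_indicator v : push P (fun u => (u \in C)%:R) v = (v \in C)%:R.
Proof.
have [vC|vC] := boolP (v \in C); last first.
  by rewrite /push big1 // => u _; rewrite P_outr ?mulr0.
apply: etrans (P_col vC); apply: eq_bigr => u _.
by have [uC|uC] := boolP (u \in C); [rewrite mul1r | rewrite P_outl ?mulr0].
Qed.

Section Mixing.
Variable q : R.
Hypothesis q_ge0 : 0 <= q.
Hypothesis S_contract : forall f, (forall v, v \notin D -> f v = 0) ->
  \sum_v f v = 0 -> \sum_v push S f v ^+ 2 <= q ^+ 2 * \sum_v f v ^+ 2.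

Let z s j v := visit_dist s j v - unif_dist R D v.

Lemma visit_diff_l2 s j : s \in D -> \sum_v z s j v ^+ 2 <= (q ^+ j) ^+ 2.
Proof.
move=> sD.
have D0 : 0 < #|D|%:R :> R by rewrite ltr0n card_gt0; apply/set0Pn; exists s.
have uE v : unif_dist R D v = (v \in D)%:R / #|D|%:R by [].
have zout i v : v \notin D -> z s i v = 0.
  by move=> vD; rewrite /z visit_out // uE (negbTE vD) mul0r subr0.
have usum : \sum_v unif_dist R D v = 1.
  by rewrite -mulr_suml sum_indicator divff // gt_eqF.
have zsum i : \sum_v z s i v = 0 by rewrite sumrB visit_mass // usum subrr.
elim: j => [|j IH].
  rewrite expr0 expr1n.
  (* The point mass at [s] is at squared distance [1 - 1 / #|D|] from uniform, so the induction
     starts below 1. *)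
  have -> : \sum_v z s 0 v ^+ 2 = 1 - 2 * (#|D|%:R)^-1 + (#|D|%:R)^-1.
    rewrite (eq_bigr (fun v => (v == s)%:R - 2 * (#|D|%:R)^-1 * (v == s)%:R +
      (#|D|%:R)^-1 * unif_dist R D v)).
      rewrite big_split /= sumrB -!mulr_sumr usum mulr1; congr (_ + _).
      by rewrite (bigD1 s) //= eqxx big1 ?addr0 ?mulr1 // => v /negbTE ->.
    move=> v _; rewrite /z /visit_dist /= uE.
    have [->|vs] := eqVneq v s; first by rewrite sD /=; ring.
    by case: (v \in D) => /=; ring.
  have := D0; rewrite -invr_gt0; lra.
have zS v : z s j.+1 v = push S (z s j) v.
  rewrite /z {1}/visit_dist iterS -/(visit_dist s j) /push.
  under [RHS]eq_bigr do rewrite mulrBl.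
  rewrite sumrB; congr (_ - _).
  rewrite (eq_bigr (fun u => (#|D|%:R)^-1 * S u v)).
    by rewrite -mulr_sumr trace_col mulrC.
  move=> u _; rewrite uE /S; case: (u \in D); last by rewrite !mul0r mulr0.
  by rewrite !mul1r.
rewrite (eq_bigr _ (fun v _ => congr1 (fun a => a ^+ 2) (zS v))).
apply: le_trans (S_contract (zout j) (zsum j)) _.
by rewrite [q ^+ j.+1]exprS exprMn ler_wpM2l ?sqr_ge0.
Qed.

Lemma visit_diff_sup s j v : s \in D -> `|z s j v| <= q ^+ j.
Proof.
move=> sD; rewrite -(@ler_pXn2r _ 2) ?nnegrE ?exprn_ge0 //.
apply: le_trans (visit_diff_l2 j sD); rewrite -normrX ger0_norm ?sqr_ge0 //.
by rewrite (bigD1 v) //= lerDl sumr_ge0 // => u _; apply: sqr_ge0.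
Qed.

Lemma push_occupation_diff s j v : s \in D ->
  push E (visit_dist s j) v - (#|D|%:R)^-1 * (v \in C)%:R = push E (z s j) v.
Proof.
move=> sD; rewrite -occupation_kernel_col mulr_sumr /push -sumrB; apply: eq_bigr
  => u _.
by rewrite /z /unif_dist mulrBl /E; case: (u \in D); rewrite ?mul1r ?mul0r ?mulr0.
Qed.

(** The first [l0] excursions are bounded by the triangle inequality, the later [m] by a geometric
    sum: the column sums of [E] carry the sup bound on [z] to all of [C]. Keeping the exact partial
    sum lets the induction on [m] close. *)
Lemma centered_occupation_le s l0 m v : s \in D -> q < 1 ->
  `|occupation s (l0 + m) v - (l0 + m)%:R / #|D|%:R * (v \in C)%:R| <=
  occupation s l0 v +
    (l0%:R / #|D|%:R + (q ^+ l0 - q ^+ (l0 + m)) / (1 - q)) * (v \in C)%:R.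
Proof.
move=> sD q1; elim: m => [|m IH].
  rewrite addn0 subrr mul0r addr0; apply: le_trans (ler_normB _ _) _.
  by rewrite ger0_norm ?occupation_ge0 // lerD2l ger0_norm ?mulr_ge0 ?invr_ge0.
have -> : occupation s (l0 + m.+1) v - (l0 + m.+1)%:R / #|D|%:R * (v \in C)%:R =
   (occupation s (l0 + m) v - (l0 + m)%:R / #|D|%:R * (v \in C)%:R) +
   push E (z s (l0 + m)) v.
  rewrite -push_occupation_diff // addnS /occupation big_ord_recr /= -[in
    LHS]natr1; ring.
apply: le_trans (ler_normD _ _) _; apply: le_trans (lerD IH (lexx _)) _.
have hz : `|push E (z s (l0 + m)) v| <= q ^+ (l0 + m) * (v \in C)%:R.
  rewrite -occupation_kernel_col mulr_sumr; apply: le_trans (ler_norm_sum _ _ _) _.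
  apply: ler_sum => u _; rewrite normrM [`|E _ _|]ger0_norm
    ?occupation_kernel_ge0 //.
  by rewrite ler_wpM2r ?occupation_kernel_ge0 // visit_diff_sup.
apply: le_trans (lerD (lexx _) hz) _.
rewrite -addrA -mulrDl lerD2l ler_wpM2r // -addrA lerD2l addnS exprS.
by rewrite le_eqVlt; apply/orP; left; apply/eqP; field; rewrite subr_eq0 eq_sym
  lt_eqF.
Qed.

End Mixing.

End Trace.

(** * Averaged orbits of a stochastic kernel in l1 norm *)

Section Averaging.
Variables (R : realType) (T : finType) (W : T -> T -> R).
Hypothesis W_ge0 : forall u v, 0 <= W u v.
Hypothesis W_row : forall u, \sum_v W u v = 1.
Implicit Types (x y w : T -> R).

Lemma eq_push (K : T -> T -> R) x y : x =1 y -> push K x =1 push K y.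
Proof. by move=> xy v; apply: eq_bigr => u _; rewrite xy. Qed.

Lemma eq_iter_push (K : T -> T -> R) l x y : x =1 y -> iter l (push K) x =1 iter
  l (push K) y.
Proof. by move=> xy; elim: l => //= l; apply: eq_push. Qed.

Lemma pushD (K : T -> T -> R) x y v :
  push K (fun u => x u + y u) v = push K x v + push K y v.
Proof. by rewrite /push -big_split /=; apply: eq_bigr => u _; rewrite mulrDl. Qed.

Lemma pushB (K : T -> T -> R) x y v :
  push K (fun u => x u - y u) v = push K x v - push K y v.
Proof. by rewrite /push -sumrB /=; apply: eq_bigr => u _; rewrite mulrBl. Qed.

Lemma iter_pushD (K : T -> T -> R) l x y v :
  iter l (push K) (fun u => x u + y u) v = iter l (push K) x v + iter l (push K)
    y v.
Proof. by elim: l v => //= l IH v; rewrite (eq_push K IH) pushD. Qed.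

Lemma iter_pushB (K : T -> T -> R) l x y v :
  iter l (push K) (fun u => x u - y u) v = iter l (push K) x v - iter l (push K)
    y v.
Proof. by elim: l v => //= l IH v; rewrite (eq_push K IH) pushB. Qed.

Lemma l1norm_ge0 x : 0 <= l1norm x.
Proof. exact: sumr_ge0. Qed.

Lemma l1norm_pushW x : l1norm (push W x) <= l1norm x.
Proof.
apply: le_trans (@l1norm_push _ _ W (fun=> 1) x _) _.
  by move=> u; rewrite -(W_row u); apply: ler_sum => v _; rewrite ger0_norm.
by apply: ler_sum => v _; rewrite mulr1.
Qed.

Lemma l1norm_iter_pushW l x : l1norm (iter l (push W) x) <= l1norm x.
Proof. by elim: l => //= l; apply: le_trans; apply: l1norm_pushW. Qed.

(** Each further step contracts what has accumulated and adds one copy of the one-step drift. *)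
Lemma l1norm_iter_drift l x :
  l1norm (fun v => iter l (push W) x v - x v) <=
  l%:R * l1norm (fun v => push W x v - x v).
Proof.
elim: l => [|l IH]; first by rewrite mul0r /l1norm big1 // => v _; rewrite subrr
  normr0.
set y := fun v => iter l (push W) x v - x v in IH.
have -> : l1norm (fun v => iter l.+1 (push W) x v - x v) =
    l1norm (fun v => push W y v + (push W x v - x v)).
  by apply: eq_bigr => v _; rewrite pushB addrA subrK.
rewrite -natr1 mulrDl mul1r; apply: (@le_trans _ _ (l1norm (push W y) + l1norm
  (fun v => push W x v - x v))).
  by rewrite /l1norm -big_split /=; apply: ler_sum => v _; apply: ler_normD.
by rewrite lerD2r (le_trans (l1norm_pushW _)).
Qed.

(* Telescoping: the average of the orbit of [w - push W w] is
   [(w - W^t w) / t], so only [w] itself has to be controlled. *)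
Lemma avg_l1_le (P : T -> T -> R) (y x w u : T -> R) (t : nat) : (0 < t)%N ->
  (forall v, w v - push P w v = y v - x v) ->
  l1norm (fun v => t%:R^-1 * \sum_(l < t) iter l (push W) y v - u v) <=
  2 * l1norm w / t%:R + l1norm (push (fun a b => W a b - P a b) w) +
  l1norm (fun v => x v - u v) + t%:R * l1norm (fun v => push W u v - u v).
Proof.
move=> t0 hw; set r := push (fun a b => W a b - P a b) w.
have t0' : 0 < t%:R :> R by rewrite ltr0n.
pose g := fun v => x v - u v.
pose a v := w v - push W w v.
(* The four summands evolve separately: [a] telescopes, the leakage [r] and the error [g] never grow
   in l1, and [u] moves only by its drift. *)
have yE : y =1 (fun v => ((a v + r v) + g v) + u v).
  move=> v; have -> : y v = x v + (w v - push P w v) by rewrite hw addrC subrK.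
  have -> : r v = push W w v - push P w v.
    by rewrite /r /push -sumrB; apply: eq_bigr => b _; rewrite mulrBr.
  by rewrite /g /a; ring.
have termE (l : nat) v : iter l (push W) y v - u v =
    (iter l (push W) w v - iter l.+1 (push W) w v) +
    (iter l (push W) r v + iter l (push W) g v + (iter l (push W) u v - u v)).
  rewrite (eq_iter_push W l yE v) (iter_pushD W l (fun v => a v + r v + g v) u).
  rewrite (iter_pushD W l (fun v => a v + r v) g) (iter_pushD W l a r).
  by rewrite (iter_pushB W l w (push W w)) -iterSr /=; ring.
have tel v : \sum_(l < t) (iter l (push W) w v - iter l.+1 (push W) w v) =
   w v - iter t (push W) w v.
  rewrite -(big_mkord xpredT (fun l => iter l (push W) w v - iter l.+1 (push W) w
    v)).
  by rewrite (telescope_sumr_eq (fun l => - iter l (push W) w v)) // => [|l _];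
    rewrite opprK addrC.
have -> : l1norm (fun v => t%:R^-1 * \sum_(l < t) iter l (push W) y v - u v) =
  t%:R^-1 * l1norm (fun v => (w v - iter t (push W) w v) +
    \sum_(l < t) (iter l (push W) r v + iter l (push W) g v + (iter l (push W) u
      v - u v))).
  rewrite /l1norm mulr_sumr; apply: eq_bigr => v _.
  rewrite -[X in X * `|_|]ger0_norm ?invr_ge0 // -normrM -tel -big_split /=.
  congr `|_|.
  under [in RHS]eq_bigr do rewrite -termE.
  rewrite sumrB sumr_const card_ord mulrBr; congr (_ - _).
  by rewrite -[u v *+ t]mulr_natl mulKf // gt_eqF.
rewrite -/g; set X := l1norm (fun v => _ + _); rewrite mulrC ler_pdivrMr //.
apply: (@le_trans _ _ ((l1norm w + l1norm (iter t (push W) w)) +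
   \sum_(l < t) (l1norm (iter l (push W) r) + l1norm (iter l (push W) g) +
     l1norm (fun v => iter l (push W) u v - u v)))).
  rewrite /X /l1norm.
  have -> : \sum_(l < t) (\sum_v `|iter l (push W) r v| + \sum_v `|iter l (push
    W) g v| +
     \sum_v `|iter l (push W) u v - u v|) = \sum_v \sum_(l < t) (`|iter l (push
       W) r v| +
     `|iter l (push W) g v| + `|iter l (push W) u v - u v|).
    by rewrite exchange_big /=; apply: eq_bigr => l _; rewrite !big_split.
  rewrite -!big_split /=; apply: ler_sum => v _.
  apply: le_trans (ler_normD _ _) _; apply: lerD; first exact: ler_normB.
  apply: le_trans (ler_norm_sum _ _ _) _; apply: ler_sum => l _.
  by apply: le_trans (ler_normD _ _) _; rewrite lerD2r ler_normD.
have h1 := l1norm_iter_pushW t w.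
have h2 : \sum_(l < t) (l1norm (iter l (push W) r) + l1norm (iter l (push W) g) +
     l1norm (fun v => iter l (push W) u v - u v)) <=
   t%:R * (l1norm r + l1norm g + t%:R * l1norm (fun v => push W u v - u v)).
  apply: (@le_trans _ _ (\sum_(l < t) (l1norm r + l1norm g + t%:R * l1norm (fun v
    => push W u v - u v)))).
    apply: ler_sum => l _; apply: lerD; first by apply: lerD; apply:
      l1norm_iter_pushW.
    apply: le_trans (l1norm_iter_drift _ _) _; rewrite ler_wpM2r ?l1norm_ge0 //.
    by rewrite ler_nat ltnW.
  by rewrite sumr_const card_ord -[X in X <= _]mulr_natl.
have -> : (2 * l1norm w / t%:R + l1norm r + l1norm g + t%:R * l1norm (fun v =>
  push W u v - u v)) * t%:R =
  2 * l1norm w + t%:R * (l1norm r + l1norm g + t%:R * l1norm (fun v => push W u v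
    - u v)).
  by field; rewrite gt_eqF.
apply: lerD => //; lra.
Qed.

End Averaging.

(** * The lazy walk on a graph of bounded degree *)

Section GraphFacts.
Variables (R : realType) (G : sgraph) (d : nat).
Hypothesis d_gt0 : (0 < d)%N.
Hypothesis G_deg : bounded_degree G d.

Lemma degree_sum (u : G) : (degree u)%:R = \sum_v (edge u v)%:R :> R.
Proof.
by rewrite /degree -(sum_indicator R); apply: eq_bigr => v _; rewrite inE.
Qed.

(** Disjointness tells the endpoints apart, so an unordered edge comes from exactly one ordered
    pair. *)
Lemma card_edges_between (H : sgraph) (S S' : {set H}) : [disjoint S & S'] ->
  #|edges_between S S'|%:R = \sum_(x in S) \sum_(y in S') (edge x y)%:R :> R.
Proof.
move=> dis.
pose A : {set H * H} := [set p | [&& p.1 \in S, p.2 \in S' & edge p.1 p.2]].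
have -> : edges_between S S' = [set [set p.1; p.2] | p in A].
  apply/setP => X; apply/imset2P/imsetP.
    move=> [x y xS]; rewrite inE => /andP[yS exy] ->.
    by exists (x, y) => //; rewrite inE /= xS yS.
  move=> [[x y]]; rewrite inE /= => /and3P[xS yS exy] ->.
  by exists x y => //; rewrite inE yS.
rewrite card_in_imset; last first.
  move=> [x y] [x' y']; rewrite !inE /= => /and3P[xS yS _] /and3P[xS' yS' _]
    /setP eX.
  have SN a b : a \in S -> b \in S' -> a != b.
    by move=> aS bS; apply: contraTneq aS => ->; rewrite (disjointFl dis).
  have := eX x; have := eX y; rewrite !inE !eqxx /= orbT.
  rewrite (negbTE (SN _ _ xS yS')) orbF [y == x']eq_sym (negbTE (SN _ _ xS' yS)) /=.
  by move=> /esym/eqP -> /esym/eqP ->.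
rewrite -sum1_card natr_sum pair_big /= big_mkcond [RHS]big_mkcond /=.
apply: eq_bigr => -[x y] _; rewrite inE /=.
by case: (x \in S) => //=; case: (y \in S') => //=; case: (edge x y).
Qed.

Lemma walk_probE (u v : G) : walk_prob R d u v =
  (u == v)%:R * (1 - (degree u)%:R / (2 * d%:R)) + (edge u v)%:R / (2 * d%:R).
Proof.
rewrite /walk_prob; case: eqVneq => [->|uv].
  by rewrite edge_irr mul0r addr0 mul1r.
by rewrite mul0r add0r; case: (edge u v); rewrite ?mul0r.
Qed.

Lemma d2_gt0 : 0 < 2 * d%:R :> R.
Proof. by rewrite mulr_gt0 ?ltr0n. Qed.

Lemma degree_le_half (u : G) : (degree u)%:R / (2 * d%:R) <= 2^-1 :> R.
Proof.
rewrite ler_pdivrMr ?d2_gt0 // mulrA mulVf ?pnatr_eq0 // mul1r ler_nat; exact: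
  G_deg.
Qed.

Lemma walk_prob_ge0 (u v : G) : 0 <= walk_prob R d u v.
Proof.
rewrite walk_probE addr_ge0 ?divr_ge0 ?(ltW d2_gt0) // mulr_ge0 //.
by have := degree_le_half u; lra.
Qed.

Lemma walk_prob_diag (u : G) : 2^-1 <= walk_prob R d u u.
Proof. by rewrite /walk_prob eqxx; have := degree_le_half u; lra. Qed.

Lemma walk_prob_sym (u v : G) : walk_prob R d u v = walk_prob R d v u.
Proof. by rewrite /walk_prob eq_sym edge_sym; case: eqVneq => // ->. Qed.

Lemma sum_delta (T : finType) (u : T) (c : R) : \sum_v (u == v)%:R * c = c.
Proof.
rewrite (bigD1 u) //= eqxx mul1r big1 ?addr0 // => v /negbTE.
by rewrite eq_sym => ->; rewrite mul0r.
Qed.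

Lemma walk_prob_row (u : G) : \sum_v walk_prob R d u v = 1.
Proof.
rewrite (eq_bigr _ (fun v _ => walk_probE u v)) big_split /= sum_delta.
by rewrite -mulr_suml -degree_sum subrK.
Qed.

Lemma walk_dist_iter (s : G) l : walk_dist R d s l = iter l (push (walk_prob R
  d)) (fun v => (v == s)%:R).
Proof. by elim: l => //= l ->. Qed.

Lemma induced_cheeger (D : {set G}) (phi : R) (f : G -> R) :
  0 < phi -> phi <= conductance R (induced D) d -> \sum_(x in D) f x = 0 ->
  phi ^+ 2 * d%:R * \sum_(x in D) f x ^+ 2 <=
  \sum_(x in D) \sum_(y in D) (edge x y)%:R * (f x - f y) ^+ 2.
Proof.
move=> phi0 hphi f0.
rewrite (big_sub D (fun x => f x ^+ 2)).
rewrite (big_sub D (fun x => \sum_(y in D) (edge x y)%:R * (f x - f y) ^+ 2)).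
under [leRHS]eq_bigr => x _ do rewrite (big_sub D (fun y => (edge (val x) y)%:R *
  (f (val x) - f y) ^+ 2)).
apply: (@cheeger _ _ (@edge (induced D)) (@edge_sym (induced D)) d phi phi0 _ _
  (fun x => f (val x))).
- move=> x; rewrite -(big_sub D (fun y => (edge (val x) y)%:R)).
  apply: (@le_trans _ _ (degree (val x))%:R); last by rewrite ler_nat; apply: G_deg.
  rewrite degree_sum big_mkcond /=; apply: ler_sum => y _.
  by case: ifP.
(* The minimum in [conductance] ranges over nonempty sets; the empty set satisfies the bound
   trivially. *)
- move=> S hS; have [->|S0] := eqVneq S set0.
    by rewrite cards0 mulr0 sumr_ge0 // => x; rewrite inE.
  have : phi <= set_conductance R d S.
    by apply: le_trans hphi _; apply: bigmin_le_cond; rewrite S0.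
  rewrite /set_conductance card_edges_between; last by rewrite disjoints_subset
    setCK.
  by rewrite ler_pdivlMr ?mulrA // mulr_gt0 ?ltr0n ?card_gt0.
- by rewrite -(big_sub D f).
Qed.

Lemma conductance_le1 (H : sgraph) : conductance R H d <= 1.
Proof. exact: bigmin_le_id. Qed.

End GraphFacts.

Lemma sum_indicatorM (R : realType) (T : finType) (S : {set T}) (F : T -> R) :
  \sum_v (v \in S)%:R * F v = \sum_(v in S) F v.
Proof.
rewrite [RHS]big_mkcond; apply: eq_bigr => v _.
by case: (v \in S); rewrite ?mul1r ?mul0r.
Qed.

(** * One cluster: the confined walk and the estimate for the averaged walk *)

Section Cluster.
Variables (R : realType) (G : sgraph) (d : nat) (C D : {set G}).
Variables (delta phi : R).
Hypothesis d_gt0 : (0 < d)%N.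
Hypothesis G_deg : bounded_degree G d.
Hypothesis D_sub_C : D \subset C.
Hypothesis D_gt0 : (0 < #|D|)%N.
Hypothesis delta_gt0 : 0 < delta.
Hypothesis delta_le : delta <= 20%:R^-1.
Hypothesis phi_gt0 : 0 < phi.
Hypothesis phi_le : phi <= conductance R (induced D) d.

Local Notation W := (walk_prob R d).
Let W_ge0 := walk_prob_ge0 R d_gt0 G_deg.

Definition leak (u : G) : R := \sum_(v in ~: C) W u v.

(* The walk confined to [C], a forbidden step being replaced by a stay; with
   probability [delta] it resamples uniformly in [C], so that every vertex of
   [C :\: D] has a positive probability of moving to [D]. *)
Definition confined (u v : G) : R :=
  (u \in C)%:R * ((v \in C)%:R *
    ((1 - delta) * (W u v + (u == v)%:R * leak u) + delta / #|C|%:R)).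
Local Notation P := confined.

Lemma leak_ge0 u : 0 <= leak u.
Proof. exact: sumr_ge0. Qed.

Lemma cluster_card_gt0 : 0 < #|C|%:R :> R.
Proof. by rewrite ltr0n (leq_trans D_gt0) // subset_leq_card. Qed.

(** A crossing edge carries probability [1 / (2 * d)] while the conductance normalises by [d];
    laziness gives the factor 1/2. *)
Lemma sum_leak : \sum_(u in C) leak u = 2^-1 * (set_conductance R d C * #|C|%:R).
Proof.
rewrite /set_conductance card_edges_between; last by rewrite disjoints_subset setCK.
have -> : \sum_(u in C) leak u =
   (\sum_(u in C) \sum_(v in ~: C) (edge u v)%:R) / (2 * d%:R).
  rewrite mulr_suml; apply: eq_bigr => u uC; rewrite mulr_suml.
  apply: eq_bigr => v; rewrite inE => vC; rewrite walk_probE.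
  by case: eqVneq => [uv|_]; [rewrite -uv uC in vC | rewrite mul0r add0r].
by field; rewrite !gt_eqF ?cluster_card_gt0 ?ltr0n.
Qed.

Lemma confined_ge0 u v : 0 <= P u v.
Proof.
have d0 := ltW delta_gt0; have d1 : 0 <= 1 - delta by have := delta_le; lra.
have k0 := leak_ge0 u.
rewrite /P !mulr_ge0 // addr_ge0 // ?divr_ge0 // mulr_ge0 // addr_ge0 ?W_ge0 //.
by rewrite mulr_ge0.
Qed.

Lemma confined_outl u v : u \notin C -> P u v = 0.
Proof. by move=> /negbTE uC; rewrite /P uC mul0r. Qed.

Lemma confined_outr u v : v \notin C -> P u v = 0.
Proof. by move=> /negbTE vC; rewrite /P vC mul0r mulr0. Qed.

Lemma confined_sym u v : P u v = P v u.
Proof.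
rewrite /P mulrCA walk_prob_sym eq_sym; congr (_ * (_ * (_ * (_ + _) + _))).
by case: eqVneq => [->|]; rewrite ?mul0r.
Qed.

Lemma walk_in_C u : \sum_(v in C) W u v = 1 - leak u.
Proof.
apply/eqP; rewrite eq_sym subr_eq; apply/eqP; rewrite -(walk_prob_row R d u).
rewrite (bigID (mem C)) /=; congr (_ + _).
by apply: eq_bigl => v; rewrite inE.
Qed.

Lemma sum_C_delta u (c : R) : u \in C -> \sum_(v in C) (u == v)%:R * c = c.
Proof.
move=> uC; rewrite (bigD1 u) //= eqxx mul1r big1 ?addr0 // => v /andP[_ /negbTE].
by rewrite eq_sym => ->; rewrite mul0r.
Qed.

Lemma confined_row u : u \in C -> \sum_v P u v = 1.
Proof.
move=> uC; rewrite /P uC.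
under eq_bigr do rewrite mul1r.
rewrite sum_indicatorM big_split /= -mulr_sumr big_split /= walk_in_C sum_C_delta
  //.
rewrite sumr_const -[(delta / _) *+ _]mulr_natr divfK ?gt_eqF ?cluster_card_gt0
  //; ring.
Qed.

Lemma confined_col v : v \in C -> \sum_u P u v = 1.
Proof. by move=> vC; rewrite -(confined_row vC); apply: eq_bigr => u _; rewrite
  confined_sym. Qed.

Let gamma := delta / #|C|%:R.

Lemma escape_rate_gt0 : 0 < gamma.
Proof. by rewrite divr_gt0 ?cluster_card_gt0. Qed.

(** Resampling alone reaches a given vertex of [D] with probability [gamma]. The rate may be tiny:
    it makes the excursion equation solvable, and the final estimates are free of [gamma]. *)
Lemma confined_escape b : b \in C :\: D -> \sum_(v in C :\: D) P b v <= 1 - gamma.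
Proof.
rewrite inE => /andP[bD bC].
have [w wD] : exists w, w \in D by apply/set0Pn; rewrite -card_gt0.
have wC := subsetP D_sub_C w wD.
rewrite lerBrDr -(confined_row bC) [leRHS](bigID (mem (C :\: D))) /= lerD2l.
rewrite (bigD1 w) /=; last by rewrite inE wD.
rewrite -[leLHS]addr0 lerD ?sumr_ge0 //; last by move=> *; apply: confined_ge0.
have d1 : 0 <= 1 - delta by have := delta_le; lra.
by rewrite /P bC wC !mul1r lerDr mulr_ge0 // addr_ge0 ?W_ge0 // mulr_ge0 ?leak_ge0.
Qed.

(** Escaping mass counts once outside [C] and once on the diagonal, where it is put back; resampling
    both removes and adds mass [delta]. *)
Lemma walk_sub_confined_row u : u \in C ->
  \sum_v `|W u v - P u v| <= 2 * leak u + 2 * delta.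
Proof.
move=> uC; have d0 := ltW delta_gt0.
rewrite (bigID (mem C)) /=.
have -> : \sum_(v | v \notin C) `|W u v - P u v| = leak u.
  apply: eq_big => [v|v vC]; first by rewrite inE.
  by rewrite confined_outr // subr0 ger0_norm.
have : \sum_(v in C) `|W u v - P u v| <=
  \sum_(v in C) ((u == v)%:R * leak u + delta * (W u v + (u == v)%:R * leak u) +
    delta / #|C|%:R).
  apply: ler_sum => v vC; rewrite /P uC vC !mul1r.
  have -> : W u v - ((1 - delta) * (W u v + (u == v)%:R * leak u) + delta /
    #|C|%:R) =
    - ((u == v)%:R * leak u) + delta * (W u v + (u == v)%:R * leak u) - delta /
      #|C|%:R by ring.
  apply: le_trans (ler_normB _ _) _; apply: lerD; last by rewrite ger0_norm //
    ltW // escape_rate_gt0.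
  apply: le_trans (ler_normD _ _) _; rewrite normrN !ger0_norm ?mulr_ge0
    ?leak_ge0 //.
  by rewrite addr_ge0 ?W_ge0 // mulr_ge0 ?leak_ge0.
rewrite !big_split /= -mulr_sumr big_split /= walk_in_C sum_C_delta //.
rewrite sumr_const -[(delta / _) *+ _]mulr_natr divfK ?gt_eqF ?cluster_card_gt0
  //; lra.
Qed.

Lemma l1norm_walk_sub_confined (w : G -> R) : (forall v, v \notin C -> w v = 0) ->
  l1norm (push (fun a b => W a b - P a b) w) <=
  2 * \sum_u `|w u| * leak u + 2 * delta * l1norm w.
Proof.
move=> w0; rewrite /l1norm !mulr_sumr -big_split /=.
apply: (@le_trans _ _ (\sum_u `|w u| * \sum_v `|W u v - P u v|)).
  exact: l1norm_push.
apply: ler_sum => u _; have [uC|uC] := boolP (u \in C); last by rewrite w0 //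
  normr0 !mul0r !mulr0 addr0.
have := ler_wpM2l (normr_ge0 (w u)) (walk_sub_confined_row uC); lra.
Qed.

Lemma unif_ge0 (T : finType) (A : {set T}) v : 0 <= unif_dist R A v.
Proof. by rewrite /unif_dist divr_ge0. Qed.

Lemma unif_out (T : finType) (A : {set T}) v : v \notin A -> unif_dist R A v = 0.
Proof. by rewrite /unif_dist => /negbTE ->; rewrite mul0r. Qed.

Lemma l1norm_unif (T : finType) (A : {set T}) : (0 < #|A|)%N -> l1norm (unif_dist
  R A) = 1.
Proof.
move=> A0; rewrite /l1norm (eq_bigr (unif_dist R A)).
  by rewrite -mulr_suml sum_indicator divff // pnatr_eq0 -lt0n.
by move=> v _; rewrite ger0_norm ?unif_ge0.
Qed.

(** The uniform law on [C] is stationary for [P], so its drift under [W] is its push by [W - P]. *)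
Lemma unif_drift : l1norm (fun v => push W (unif_dist R C) v - unif_dist R C v) <=
  set_conductance R d C + 2 * delta.
Proof.
have -> : l1norm (fun v => push W (unif_dist R C) v - unif_dist R C v) =
   l1norm (push (fun a b => W a b - P a b) (unif_dist R C)).
  apply: eq_bigr => v _; congr `|_|.
  have -> : unif_dist R C v = push P (unif_dist R C) v.
    rewrite /unif_dist -(push_kernel_indicator confined_outl confined_outr
      confined_col) /push mulr_suml.
    by apply: eq_bigr => u _; rewrite mulrAC.
  by rewrite /push -sumrB; apply: eq_bigr => u _; rewrite mulrBr.
apply: le_trans (l1norm_walk_sub_confined _) _; first by move=> v; apply: unif_out.
rewrite l1norm_unif ?mulr1 ?lerD2r; last by rewrite -(ltr0n R) cluster_card_gt0.
rewrite (eq_bigr (fun u => (#|C|%:R)^-1 * ((u \in C)%:R * leak u))); last first.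
  by move=> u _; rewrite ger0_norm ?unif_ge0 // /unif_dist mulrAC mulrC.
rewrite -mulr_sumr sum_indicatorM sum_leak.
by rewrite le_eqVlt; apply/orP; left; apply/eqP; field; rewrite gt_eqF
  ?cluster_card_gt0.
Qed.

Lemma unif_sub_l1 : l1norm (fun v => unif_dist R D v - unif_dist R C v) =
  2 * (#|C :\: D|%:R / #|C|%:R).
Proof.
have D0 : 0 < #|D|%:R :> R by rewrite ltr0n.
have DC : #|D|%:R <= #|C|%:R :> R by rewrite ler_nat subset_leq_card.
have -> : l1norm (fun v => unif_dist R D v - unif_dist R C v) =
  \sum_v ((v \in D)%:R * ((#|D|%:R)^-1 - (#|C|%:R)^-1) + (v \in C :\: D)%:R *
    (#|C|%:R)^-1).
  apply: eq_bigr => v _; rewrite /unif_dist inE.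
  have [vD|vD] := boolP (v \in D); rewrite /= ?(subsetP D_sub_C v vD) ?mul1r
    ?mul0r ?addr0 ?add0r ?sub0r.
    by rewrite ger0_norm // subr_ge0 lef_pV2 ?posrE ?cluster_card_gt0.
  by rewrite normrN ger0_norm ?mulr_ge0 ?invr_ge0.
rewrite big_split /= -!mulr_suml !sum_indicator.
have -> : #|C :\: D|%:R = #|C|%:R - #|D|%:R :> R.
  by rewrite cardsD (setIidPr D_sub_C) natrB // subset_leq_card.
by field; rewrite !gt_eqF ?cluster_card_gt0.
Qed.

Let q : R := 1 - phi ^+ 2 / 10%:R.

Lemma core_expansion_le1 : phi <= 1.
Proof. exact: le_trans phi_le (conductance_le1 _ _ _). Qed.

Lemma rate_ge0 : 0 <= q.
Proof. by rewrite /q; have := core_expansion_le1; have := phi_gt0; nra. Qed.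

Lemma rate_lt1 : q < 1.
Proof. by rewrite /q; have := phi_gt0; nra. Qed.

Section TraceChain.
Variable H : G -> G -> R.
Hypothesis H_ge0 : forall u v, 0 <= H u v.
Hypothesis H_eq : forall u v, H u v = P u v + \sum_(b in C :\: D) H u b * P b v.
Local Notation S := (trace_kernel D H).

(** The watched chain dominates [P] on [D], so it holds with probability at least [(1 - delta) / 2]
    and crosses each core edge with probability at least [(1 - delta) / (2 * d)]. Hence
    [l2_dissipation] bounds the loss below by the Dirichlet form of the induced graph, which
    [induced_cheeger] controls. *)
Lemma trace_contract f : (forall v, v \notin D -> f v = 0) ->
  \sum_v f v = 0 -> \sum_v push S f v ^+ 2 <= q ^+ 2 * \sum_v f v ^+ 2.
Proof.
move=> f0 fs.
have sumD (F : R -> R) : F 0 = 0 -> \sum_v F (f v) = \sum_(v in D) F (f v).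
  move=> F0; rewrite [RHS]big_mkcond; apply: eq_bigr => v _.
  by case: ifPn => // /f0 ->.
have fs' : \sum_(v in D) f v = 0 by rewrite -(sumD id).
have Vsum : \sum_v f v ^+ 2 = \sum_(v in D) f v ^+ 2.
  by rewrite (sumD (fun a => a ^+ 2)) // expr0n.
have hch := induced_cheeger d_gt0 G_deg phi_gt0 phi_le fs'.
rewrite -Vsum in hch.
set V := \sum_v f v ^+ 2 in hch *.
have V0 : 0 <= V by apply: sumr_ge0 => v _; apply: sqr_ge0.
have S_out u v : v \notin D -> S u v = 0.
  by rewrite /trace_kernel => /negbTE ->; rewrite mul0r mulr0.
have S_col' v : v \in D -> \sum_u S u v = 1.
  by move=> vD; rewrite (trace_col D_sub_C confined_ge0 confined_outl
    confined_outr confined_col escape_rate_gt0 confined_escape H_eq) vD.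
have S_row' u : u \in D -> \sum_v S u v = 1.
  exact: (trace_row D_sub_C confined_outr confined_row H_eq).
have hdis := l2_dissipation (trace_ge0 D H_ge0) S_out S_row' S_col' f0.
have SP u v : u \in D -> v \in D -> P u v <= S u v.
  by move=> uD vD; rewrite /trace_kernel uD vD !mul1r (kernel_le_excursion
    confined_ge0 H_ge0 H_eq).
have e1 : 0 <= 1 - delta by have := delta_le; lra.
have Pdiag v : v \in D -> (1 - delta) / 2 <= P v v.
  move=> vD; have vC := subsetP D_sub_C v vD; rewrite /P vC !mul1r eqxx mul1r.
  rewrite -[leLHS]addr0 lerD ?(ltW escape_rate_gt0) // ler_wpM2l //.
  by rewrite -[leLHS]addr0 lerD ?leak_ge0 // walk_prob_diag.
have Pedge u v : u \in D -> v \in D -> (1 - delta) * ((edge u v)%:R / (2 * d%:R))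
  <= P u v.
  move=> uD vD; rewrite /P !(subsetP D_sub_C) // !mul1r.
  rewrite -[leLHS]addr0 lerD ?(ltW escape_rate_gt0) // ler_wpM2l //.
  rewrite -[leLHS]addr0 lerD ?mulr_ge0 ?leak_ge0 // walk_probE lerDr mulr_ge0 //.
  by have := degree_le_half R d_gt0 G_deg u; lra.
have hlow : ((1 - delta) / 2) * ((1 - delta) / (2 * d%:R)) *
    \sum_(v in D) \sum_(u in D) (edge v u)%:R * (f v - f u) ^+ 2 <=
   \sum_(v in D) S v v * \sum_u S u v * (f u - f v) ^+ 2.
  rewrite mulr_sumr; apply: ler_sum => v vD; rewrite -mulrA ler_pM //.
  - by rewrite divr_ge0.
  - by rewrite mulr_ge0 ?divr_ge0 ?mulr_ge0 // sumr_ge0 // => u _; rewrite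
    mulr_ge0 ?sqr_ge0.
  - exact: le_trans (Pdiag v vD) (SP v v vD vD).
  rewrite mulr_sumr [leRHS](bigID (mem D)) /= -[leLHS]addr0 lerD //; last first.
    by apply: sumr_ge0 => u _; rewrite mulr_ge0 ?sqr_ge0 // trace_ge0.
  apply: ler_sum => u uD.
  have -> : (f u - f v) ^+ 2 = (f v - f u) ^+ 2 by ring.
  rewrite mulrA ler_wpM2r ?sqr_ge0 //.
  apply: le_trans (SP u v uD vD); apply: le_trans (Pedge u v uD vD).
  by rewrite edge_sym le_eqVlt; apply/orP; left; apply/eqP; ring.
have dR : 0 < d%:R :> R by rewrite ltr0n.
have hc : ((1 - delta) / 2) * ((1 - delta) / (2 * d%:R)) * (phi ^+ 2 * d%:R * V) =
   (1 - delta) ^+ 2 / 4%:R * (phi ^+ 2 * V) by field; rewrite gt_eqF.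
have hfin : (1 - delta) ^+ 2 / 4%:R * (phi ^+ 2 * V) <= V - \sum_v push S f v ^+ 2.
  rewrite -hc; apply: le_trans hdis; apply: le_trans hlow; rewrite ler_wpM2l //.
  by rewrite mulr_ge0 ?divr_ge0 ?mulr_ge0.
have hphi : 0 <= phi ^+ 2 * V by rewrite mulr_ge0 ?sqr_ge0.
(* As [delta <= 1/20], the loss is at least [phi ^+ 2 / 5] times [V], and
   [1 - phi ^+ 2 / 5 <= q ^+ 2]. *)
have h4 : 5%:R^-1 <= (1 - delta) ^+ 2 / 4%:R.
  by have := delta_le; have := delta_gt0; nra.
have h5 := ler_wpM2r hphi h4.
have h6 : 0 <= (phi ^+ 2 / 10%:R) ^+ 2 * V by rewrite mulr_ge0 ?sqr_ge0.
rewrite /q; nra.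
Qed.

End TraceChain.

(** [occ] is exposed with its column sums so that good starts can be selected before [t] and [m] are
    fixed. Only the term with [q ^+ (l0 + m)] depends on [m], so it can be made negligible at no
    cost. *)
Lemma cluster_walk_bound (l0 : nat) : exists occ : G -> G -> R,
  [/\ forall s v, 0 <= occ s v,
      forall v, \sum_(s in D) occ s v = l0%:R * (v \in C)%:R
    & forall (s : G) (t m : nat) (L mass : R), s \in D -> (0 < t)%N ->
      L = l0%:R / #|D|%:R + q ^+ l0 / (1 - q) ->
      mass = l0%:R + \sum_(v in C :\: D) occ s v + L * #|C|%:R ->
      l1norm (fun v => avg_walk_dist R d s t v - unif_dist R C v) <=
      2 * mass / t%:R +
      (2 * (\sum_(v in C) occ s v * leak v + L * \sum_(v in C) leak v) + 2 *
        delta * mass) +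
      (#|D|%:R * q ^+ (l0 + m) + 2 * (#|C :\: D|%:R / #|C|%:R)) +
      t%:R * (set_conductance R d C + 2 * delta)].
Proof.
have [H H_ge0 H_eq] := excursion_kernel confined_ge0 escape_rate_gt0
  confined_escape.
have occ_out := occupation_out D_sub_C confined_ge0 confined_outl confined_outr
  confined_col escape_rate_gt0 confined_escape H_ge0 H_eq.
exists (fun s v => occupation C D H s l0 v); split.
- by move=> s v; apply: occupation_ge0.
- exact: (sum_occupation D_sub_C confined_ge0 confined_outl confined_outr
  confined_col escape_rate_gt0 confined_escape H_eq).
move=> s t m L mass sD t0 LE massE.
set occ := occupation C D H s l0 in massE *.
pose l := (l0 + m)%N.
(* The subtracted term is the occupation from a uniform start in [D], which is constant on [C]. *)
pose w v := occupation C D H s l v - l%:R / #|D|%:R * (v \in C)%:R.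
have w_out v : v \notin C -> w v = 0.
  by move=> vC; rewrite /w occ_out // (negbTE vC) mulr0 subr0.
have w_le v : `|w v| <= occ v + L * (v \in C)%:R.
  apply: le_trans (centered_occupation_le D_sub_C confined_ge0 confined_outl
    confined_outr confined_row confined_col escape_rate_gt0
    confined_escape H_ge0 H_eq rate_ge0 (trace_contract H_ge0 H_eq) l0 m v sD
      rate_lt1) _.
  rewrite lerD2l ler_wpM2r // LE lerD2l ler_wpM2r ?invr_ge0 ?subr_ge0 ?(ltW
    rate_lt1) //.
  by rewrite lerBlDr lerDl exprn_ge0 // rate_ge0.
have w_pois v : w v - push P w v = (v == s)%:R - visit_dist D H s l v.
  have -> : push P w v = push P (occupation C D H s l) v - l%:R / #|D|%:R * (v
    \in C)%:R.
    rewrite /w pushB; congr (_ - _).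
    rewrite -(push_kernel_indicator confined_outl confined_outr confined_col v)
      /push mulr_sumr.
    by apply: eq_bigr => u _; rewrite !mulrA.
  rewrite /w -(occupation_poisson confined_outr H_eq) //; ring.
have := avg_l1_le W_ge0 (walk_prob_row R d) (unif_dist R C) t0 w_pois.
have -> : l1norm (fun v => t%:R^-1 * \sum_(i < t) iter i (push W) (fun v => (v ==
  s)%:R) v - unif_dist R C v)
  = l1norm (fun v => avg_walk_dist R d s t v - unif_dist R C v).
  apply: eq_bigr => v _; rewrite /avg_walk_dist; congr (`|_ * _ - _|).
  by apply: eq_bigr => i _; rewrite walk_dist_iter.
move/le_trans; apply.
have hmass : l1norm w <= mass.
  rewrite massE.
  apply: (@le_trans _ _ (\sum_v (occ v + L * (v \in C)%:R))); first exact: ler_sum.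
  rewrite big_split /= -mulr_sumr sum_indicator (@sum_core_rest _ _ C D) //; last
    by move=> v; apply: occ_out.
  by rewrite (occupation_D D_sub_C confined_outr confined_row H_eq).
have hleak : \sum_u `|w u| * leak u <= \sum_(v in C) occ v * leak v + L * \sum_(v
  in C) leak v.
  rewrite mulr_sumr -!(sum_indicatorM C) -big_split /=.
  apply: ler_sum => v _; have [vC|vC] := boolP (v \in C); last first.
    by rewrite w_out // normr0 !mul0r addr0.
  rewrite !mul1r -mulrDl ler_wpM2r ?leak_ge0 //.
  by have := w_le v; rewrite vC mulr1.
have hx : l1norm (fun v => visit_dist D H s l v - unif_dist R C v) <=
   #|D|%:R * q ^+ l + 2 * (#|C :\: D|%:R / #|C|%:R).
  rewrite -unif_sub_l1 /l1norm.
  apply: (@le_trans _ _ (\sum_v (`|visit_dist D H s l v - unif_dist R D v| +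
     `|unif_dist R D v - unif_dist R C v|))).
    apply: ler_sum => v _; apply: le_trans (ler_normD _ _).
    by rewrite addrA subrK.
  rewrite big_split /= lerD2r -sum_indicator mulr_suml; apply: ler_sum => v _.
  have [vD|vD] := boolP (v \in D); last first.
    by rewrite visit_out // unif_out // subrr normr0 mul0r.
  rewrite mul1r; apply: (visit_diff_sup D_sub_C confined_ge0 confined_outl
    confined_outr confined_row confined_col escape_rate_gt0
    confined_escape H_eq rate_ge0 (trace_contract H_ge0 H_eq)) => //.
have t0' : 0 < t%:R :> R by rewrite ltr0n.
apply: lerD; first apply: lerD; first apply: lerD.
- by rewrite ler_wpM2r ?invr_ge0 // ler_pM2l.
- apply: le_trans (l1norm_walk_sub_confined w_out) _; apply: lerD; first by
  rewrite ler_pM2l.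
  by rewrite ler_wpM2l // mulr_ge0 // ltW.
- exact: hx.
- by rewrite ler_wpM2l // unif_drift.
Qed.

End Cluster.

(** * Selection of good starts and numerical constants *)

Lemma markov_card (R : realType) (T : finType) (A : {set T}) (F : T -> R) (c : R) :
  (forall s, 0 <= F s) ->
  c * #|[set s in A | c < F s]|%:R <= \sum_(s in A) F s.
Proof.
move=> F0; rewrite mulr_natr -sumr_const.
apply: (@le_trans _ _ (\sum_(s in [set s in A | c < F s]) F s)).
  by apply: ler_sum => s; rewrite inE => /andP[_ /ltW].
rewrite big_mkcond [leRHS]big_mkcond /=; apply: ler_sum => s _; rewrite inE.
by case: (s \in A) => //=; case: ifP.
Qed.

(** From [1 - c <= expR (- c)]. *)
Lemma pow_le_inv (R : realType) (c y : R) (l : nat) : 0 < c <= 1 -> 0 < y ->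
  ln y / c <= l%:R -> (1 - c) ^+ l <= y^-1.
Proof.
move=> /andP[c0 c1] y0; rewrite ler_pdivrMr // => hl.
apply: (@le_trans _ _ (expR (- c) ^+ l)).
  by rewrite lerXn2r ?nnegrE ?subr_ge0 ?expR_ge0 // expR_ge1Dx.
rewrite -expRM_natr mulNr expRN lef_pV2 ?posrE ?expR_gt0 //.
by rewrite -[leLHS]lnK ?posrE // ler_expR mulrC.
Qed.

(** From [ln x <= x - 1] at [x = 1 / n]. It lets additive rounding errors be absorbed into multiples
    of [ln n]. *)
Lemma ln_ge_half (R : realType) (n : nat) : (1 < n)%N -> 2^-1 <= ln n%:R :> R.
Proof.
move=> n1.
have n0 : 0 < n%:R :> R by rewrite ltr0n (ltn_trans _ n1).
have hn : (n%:R)^-1 <= 2^-1 :> R by rewrite lef_pV2 ?posrE // ler_nat.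
have := @le_ln1Dx R ((n%:R)^-1 - 1).
rewrite ltrBrDl subrr invr_gt0 n0 => /(_ isT).
rewrite addrC subrK lnV ?posrE //; lra.
Qed.

Lemma cluster_mixing (R : realType) (kappa eps phi : R) (d n : nat) (G : sgraph)
  (C D : {set G}) :
  0 < kappa < 1 -> 0 < eps < 1 -> 0 < phi -> (0 < d)%N -> (1 < n)%N -> #|G| = n ->
  bounded_degree G d -> D \subset C ->
  set_conductance R d C <= 1000^-1 * eps * kappa ^+ 4 * phi ^+ 2 / ln n%:R ->
  phi <= conductance R (induced D) d ->
  #|C :\: D|%:R <= eps * n%:R ->
  3 * Num.sqrt eps * n%:R <= #|D|%:R ->
  exists Dhat : {set G},
    [/\ Dhat \subset D,
        (1 - 4 * Num.sqrt eps) * #|D|%:R <= #|Dhat|%:R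
      & forall s : G, s \in Dhat -> forall t : nat,
          `|t%:R - 120 * ln n%:R / (kappa * phi ^+ 2)| < 1 ->
          tv_dist (avg_walk_dist R d s t) (unif_dist R C) < kappa + Num.sqrt eps].
Proof.
move=> /andP[k0 k1] /andP[e0 e1] p0 d0 n1 Gn Gdeg DC hcond hphi hB hD.
have n0 : 0 < n%:R :> R by rewrite ltr0n (ltn_trans _ n1).
have lnh := ln_ge_half R n1.
have p1 : phi <= 1 := le_trans hphi (conductance_le1 _ _ _).
have p20 : 0 < phi ^+ 2 by rewrite exprn_gt0.
have p21 : phi ^+ 2 <= 1 by rewrite exprn_ile1 // ltW.
set r := Num.sqrt eps in hD *.
have r0 : 0 < r by rewrite sqrtr_gt0.
have r2 : r ^+ 2 = eps by rewrite sqr_sqrtr // ltW.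
have Dn : #|D|%:R <= n%:R :> R by rewrite ler_nat -Gn max_card.
have Dpos : 0 < #|D|%:R :> R by apply: lt_le_trans hD; rewrite !mulr_gt0.
have Dpos' : (0 < #|D|)%N by rewrite -(ltr0n R).
have r3 : r <= 3^-1.
  have : 3 * r * n%:R <= 1 * n%:R by rewrite mul1r; apply: le_trans hD Dn.
  by rewrite ler_pM2r // => h; clear -h; lra.
(* Of the two factors [r] in [eps = r ^+ 2], one is spent against [3 * r * n <= #|D|]. *)
have hBr : 3 * #|C :\: D|%:R <= r * #|D|%:R.
  have h := ler_wpM2l (ltW r0) hD; rewrite -r2 in hB; clear -h hB; lra.
have Ccard : #|C|%:R = #|D|%:R + #|C :\: D|%:R :> R.
  by rewrite -natrD cardsD (setIidPr DC) subnKC // subset_leq_card.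
have CD : 9 * #|C|%:R <= 10 * #|D|%:R :> R.
  have h : r * #|D|%:R <= 3^-1 * #|D|%:R by rewrite ler_pM2r.
  by clear -h hBr Ccard; lra.
have Cpos : 0 < #|C|%:R :> R.
  by rewrite Ccard; apply: ltr_wpDr.
pose X := ln n%:R / phi ^+ 2.
have Xp : X * phi ^+ 2 = ln n%:R by rewrite /X divfK // gt_eqF.
have Xh : 2^-1 <= X.
  by rewrite ler_pdivlMr //; apply: le_trans lnh; clear -p21; lra.
have X0 : 0 < X by clear -Xh; lra.
(* At least [10 * X] visits bring [q ^+ l0] below [1 / n]; rounding up costs at most
   [1 <= 2 * X]. *)
pose l0 := (Num.trunc (10 * X)).+1.
have l0lo : 10 * X <= l0%:R by rewrite ltW // /l0 truncnS_gt.
have l0hi : l0%:R <= 12 * X.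
  have /andP[h _] := truncn_itv (x := 10 * X) (ltW (mulr_gt0 (ltr0n _ 10) X0)).
  by rewrite /l0 -natr1; clear -h Xh; lra.
(* Chosen so that resampling during [t] steps, about [120 * X / kappa] of them, costs only a small
   multiple of [kappa]. *)
pose delta := kappa ^+ 2 / (1000 * X).
have Xne : X != 0 by rewrite gt_eqF.
have dX : delta * X = kappa ^+ 2 / 1000 by rewrite /delta; field.
have dp : 0 < delta by rewrite divr_gt0 ?exprn_gt0 // mulr_gt0.
have k2 : kappa ^+ 2 <= kappa by rewrite expr2 ler_piMr // ltW.
have dle : delta <= 20^-1.
  have h := ler_wpM2l (ltW dp) Xh; rewrite dX in h.
  by clear -h k2 k1; lra.
have [occ [occ0 occS occB]] := cluster_walk_bound d0 Gdeg DC Dpos' dp dle p0 hphi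
  l0.
set phiC := set_conductance R d C in hcond occB.
have phiC0 : 0 <= phiC by rewrite /phiC /set_conductance divr_ge0 // mulr_ge0.
have hphiX : phiC * X <= 1000^-1 * eps * kappa ^+ 4.
  move: hcond; rewrite ler_pdivlMr; last by clear -lnh; lra.
  by rewrite -Xp mulrA ler_pM2r.
pose F1 s := \sum_(v in C :\: D) occ s v.
pose F2 s := \sum_(v in C) occ s v * leak R d C v.
have lk0 v : 0 <= leak R d C v by apply: leak_ge0.
have F10 s : 0 <= F1 s by apply: sumr_ge0.
have F20 s : 0 <= F2 s by apply: sumr_ge0 => v _; rewrite mulr_ge0.
have F1s : \sum_(s in D) F1 s = l0%:R * #|C :\: D|%:R.
  rewrite exchange_big /= (eq_bigr (fun=> l0%:R)) => [|v]; first by rewrite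
    sumr_const mulr_natr.
  by rewrite inE => /andP[_ vC]; rewrite occS vC mulr1.
have lks : \sum_(v in C) leak R d C v = 2^-1 * (phiC * #|C|%:R).
  exact: (sum_leak R d0 DC Dpos').
have F2s : \sum_(s in D) F2 s = l0%:R * (2^-1 * (phiC * #|C|%:R)).
  rewrite exchange_big /= -lks mulr_sumr; apply: eq_bigr => v vC.
  by rewrite -mulr_suml occS vC mulr1.
(* The discarded starts spend too long in [C :\: D] or leak too much. Markov's inequality leaves at
   most [r / 3] and [r] times [#|D|] of them, within the allowed [4 * r]. *)
set bad1 := [set s in D | l0%:R < F1 s].
set bad2 := [set s in D | kappa / 100 < F2 s].
have hbad1 : #|bad1|%:R <= #|C :\: D|%:R :> R.
  have := markov_card D l0%:R F10; rewrite F1s ler_pM2l //.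
have hbad2 : #|bad2|%:R <= r * #|D|%:R :> R.
  have := markov_card D (kappa / 100) F20; rewrite F2s -/bad2 => hm.
  have h1 : l0%:R * phiC <= 12 * (1000^-1 * eps * kappa ^+ 4).
    apply: (@le_trans _ _ (12 * X * phiC)); first by rewrite ler_wpM2r.
    by rewrite -mulrA ler_pM2l // mulrC.
  have h2 : kappa / 100 * #|bad2|%:R <= kappa * (6 / 1000 * eps * #|C|%:R).
    apply: le_trans hm _.
    have h3 := ler_wpM2r (ltW Cpos) h1.
    have h4 : kappa ^+ 4 * (eps * #|C|%:R) <= kappa * (eps * #|C|%:R).
      rewrite ler_pM2r ?mulr_gt0 // -[leRHS]expr1 ler_wiXn2l // ltW //.
    by clear -h3 h4; lra.
  have h3 : eps * #|C|%:R <= r * #|D|%:R.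
    rewrite -r2 expr2 -mulrA ler_pM2l //.
    have h : r * #|C|%:R <= 3^-1 * #|C|%:R by rewrite ler_pM2r.
    by clear -h CD Dpos; lra.
  have h4 : 100^-1 * #|bad2|%:R <= 6 / 1000 * eps * #|C|%:R.
    by rewrite -(ler_pM2l k0); clear -h2; lra.
  have h : 0 <= r * #|D|%:R by rewrite mulr_ge0 // ltW.
  by clear -h h3 h4; lra.
exists (D :\: (bad1 :|: bad2)); split; first exact: subsetDl.
  have hc : (#|D| <= #|D :\: (bad1 :|: bad2)| + (#|bad1| + #|bad2|))%N.
    rewrite -(cardsID (bad1 :|: bad2) D) addnC leq_add2l.
    by rewrite (leq_trans (subset_leq_card (subsetIr _ _))) // leq_card_setU.
  have h1 : #|D|%:R <= #|D :\: (bad1 :|: bad2)|%:R + (#|bad1|%:R + #|bad2|%:R) :> R.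
    by rewrite -!natrD ler_nat.
  have h2 : 0 <= r * #|D|%:R by rewrite mulr_ge0 // ltW.
  by clear -h1 h2 hbad1 hbad2 hBr; lra.
move=> s; rewrite !inE negb_or => /andP[/andP[s1 s2] sD] t ht.
rewrite sD /= -leNgt in s1; rewrite sD /= -leNgt in s2.
have kp : 120 * ln n%:R / (kappa * phi ^+ 2) = 120 * X / kappa.
  by rewrite -Xp; field; rewrite !gt_eqF.
rewrite kp in ht.
(* The rounding of [t] shifts [kappa * t] by less than [kappa < 1 <= 2 * X]. *)
have [tlo thi] : 118 * X <= kappa * t%:R /\ kappa * t%:R <= 122 * X.
  move: ht; rewrite ltr_norml => /andP[h1 h2].
  have h3 : 120 * X = kappa * (120 * X / kappa) by field; rewrite gt_eqF.
  have h4 : kappa * (-1) < kappa * (t%:R - 120 * X / kappa) by rewrite ltr_pM2l.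
  have h5 : kappa * (t%:R - 120 * X / kappa) < kappa * 1 by rewrite ltr_pM2l.
  by clear -h3 h4 h5 Xh k1; split; lra.
have t0 : 0 < t%:R :> R.
  by rewrite -(pmulr_rgt0 _ k0); apply: lt_le_trans tlo; rewrite mulr_gt0.
have t0' : (0 < t)%N by rewrite -(ltr0n R).
pose q : R := 1 - phi ^+ 2 / 10.
have c01 : 0 < phi ^+ 2 / 10 <= 1 by apply/andP; split; [rewrite divr_gt0 | clear
  -p21; lra].
have ql0 : q ^+ l0 <= (n%:R)^-1.
  apply: pow_le_inv => //; apply: le_trans l0lo.
  by rewrite -Xp le_eqVlt; apply/orP; left; apply/eqP; field; rewrite gt_eqF.
(* The target for [q ^+ (l0 + m)] is [1 / y], which beats the factor [#|D| <= n] and leaves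
   [kappa / 100]. *)
pose y : R := 100 * n%:R / kappa.
have y0 : 0 < y by rewrite divr_gt0 // mulr_gt0.
pose m := (Num.trunc (ln y / (phi ^+ 2 / 10))).+1.
have qm : #|D|%:R * q ^+ (l0 + m) <= kappa / 100.
  have h1 : q ^+ (l0 + m) <= y^-1.
    apply: pow_le_inv => //; rewrite (le_trans (ltW (truncnS_gt _))) // ler_nat.
    exact: leq_addl.
  apply: (@le_trans _ _ (n%:R * y^-1)).
    by apply: ler_pM => //; apply: exprn_ge0; rewrite /q subr_ge0; case/andP: c01.
  by rewrite /y le_eqVlt; apply/orP; left; apply/eqP; field; rewrite !gt_eqF.
pose L := l0%:R / #|D|%:R + q ^+ l0 / (1 - q).
have LE : L = l0%:R / #|D|%:R + q ^+ l0 / (1 - q) by [].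
have q1 : 1 - q = phi ^+ 2 / 10 by rewrite /q opprB addrC subrK.
(* The [l0] visits give [12 * X]. The geometric tail gives at most [10 / phi ^+ 2 <= 20 * X],
   because [q ^+ l0 * #|D| <= 1] and [ln n >= 1/2]. *)
have LD : L * #|D|%:R <= 32 * X.
  have -> : L * #|D|%:R = l0%:R + q ^+ l0 * #|D|%:R * (10 / phi ^+ 2).
    have -> : L = l0%:R / #|D|%:R + q ^+ l0 / (phi ^+ 2 / 10) by rewrite LE q1.
    by move: (q ^+ l0) => ql; field; rewrite !gt_eqF.
  have h1 : q ^+ l0 * #|D|%:R <= 1.
    apply: (@le_trans _ _ ((n%:R)^-1 * n%:R)); last by rewrite mulVf // gt_eqF.
    by apply: ler_pM => //; apply: exprn_ge0; rewrite /q subr_ge0; case/andP: c01.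
  have h2 : 10 / phi ^+ 2 <= 20 * X.
    by rewrite ler_pdivrMr // -mulrA Xp; clear -lnh; lra.
  have h3 : q ^+ l0 * #|D|%:R * (10 / phi ^+ 2) <= 1 * (10 / phi ^+ 2).
    by rewrite ler_wpM2r // divr_ge0 // ltW.
  rewrite mul1r in h3; apply: le_trans (lerD l0hi (le_trans h3 h2)) _.
  by clear -X0; lra.
have L0 : 0 <= L.
  case/andP: c01 => c0 c1; rewrite LE q1; apply: addr_ge0; first by rewrite
    divr_ge0.
  by rewrite mulr_ge0 ?invr_ge0 ?(ltW c0) // exprn_ge0 // /q subr_ge0.
have LC : L * #|C|%:R <= 36 * X.
  have h := ler_wpM2l L0 CD.
  by clear -h LD X0; lra.
pose mass := l0%:R + F1 s + L * #|C|%:R.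
(* The visits to the core, the time in the rest and the uniform part contribute 12, 12 and 36 times
   [X]. *)
have hmass : mass <= 60 * X by rewrite /mass; clear -l0hi s1 LC; lra.
have := occB s t m L mass sD t0' LE erefl.
rewrite -/(F2 s) lks => hb.
have hb1 : 2 * mass / t%:R <= 2 * (51 / 100 * kappa).
  by rewrite ler_pdivrMr //; clear -hmass tlo Xh; lra.
have k4 : eps * kappa ^+ 4 <= kappa ^+ 2.
  have h1 : kappa ^+ 4 <= kappa ^+ 2 by rewrite ler_wiXn2l // ltW.
  apply: le_trans h1; rewrite ger_pMl //; first exact: ltW.
  by rewrite exprn_gt0.
have hb2 : L * (2^-1 * (phiC * #|C|%:R)) <= 18 / 1000 * kappa.
  have h := ler_wpM2r phiC0 LC.
  by clear -h hphiX k4 k2; lra.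
have hb3 : 2 * delta * mass <= 120 / 1000 * kappa.
  have h := ler_wpM2l (ltW dp) hmass.
  by clear -h dX k2; lra.
have hb4 : t%:R * (phiC + 2 * delta) <= (122 / 1000 + 244 / 1000) * kappa.
  rewrite -(ler_pM2l k0) mulrA.
  apply: (@le_trans _ _ (122 * X * (phiC + 2 * delta))).
    by rewrite ler_wpM2r // addr_ge0 // mulr_ge0 // ltW.
  by clear -hphiX dX k4; lra.
have hb5 : #|C :\: D|%:R / #|C|%:R <= r / 3.
  rewrite ler_pdivrMr //.
  have h : r * #|D|%:R <= r * #|C|%:R by rewrite ler_pM2l // Ccard lerDl.
  by clear -h hBr; lra.
rewrite /tv_dist -/(l1norm (fun v => avg_walk_dist R d s t v - unif_dist R C v)).
(* After halving, the coefficients of [kappa] add up to 0.786 and [r] enters with coefficient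
   1/3. *)
have budget (N a1 a2 a3 a4 a5 a6 a7 : R) :
    N <= a1 + (2 * (a2 + a3) + a4) + (a5 + 2 * a6) + a7 ->
    a1 <= 2 * (51 / 100 * kappa) -> a2 <= kappa / 100 ->
    a3 <= 18 / 1000 * kappa -> a4 <= 120 / 1000 * kappa -> a5 <= kappa / 100 ->
    a6 <= r / 3 -> a7 <= (122 / 1000 + 244 / 1000) * kappa ->
    2^-1 * N < kappa + r.
  by move: (k0) (r0); clear; lra.
exact: (budget _ _ _ _ _ _ _ _ hb hb1 s2 hb2 hb3 qm hb5 hb4).
Qed.

Theorem theorem3 (R : realType) :
  exists a : R, 0 < a /\
  forall (kappa eps phi_in phi_out : R) (k d n : nat) (G : sgraph)
         (h : nat) (C D : 'I_h -> {set G}),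
    0 < kappa < 1 -> 0 < eps < 1 -> 0 < phi_in ->
    (0 < d)%N -> (1 < n)%N -> (h <= k)%N ->
    phi_out <= a * eps * kappa ^+ 4 * phi_in ^+ 2 / (k%:R ^+ 3 * ln n%:R) ->
    #|G| = n ->
    bounded_degree G d ->
    is_ordered_partition C ->
    (forall i, set_conductance R d (C i) <= phi_out) ->
    (forall i, D i \subset C i) ->
    (forall i, phi_in <= conductance R (induced (D i)) d) ->
    (\sum_(i < h) #|C i :\: D i|)%:R <= eps * n%:R ->
    forall j : 'I_h,
      3 * Num.sqrt eps * n%:R <= #|D j|%:R ->
      exists Dhat : {set G},
        [/\ Dhat \subset D j,
            (1 - 4 * Num.sqrt eps) * #|D j|%:R <= #|Dhat|%:R
          & forall s : G, s \in Dhat ->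
            forall t : nat,
              `|t%:R - 120 * ln n%:R / (kappa * phi_in ^+ 2)| < 1 ->
              tv_dist (avg_walk_dist R d s t) (unif_dist R (C j))
                < kappa + Num.sqrt eps].
Proof.
exists (1000^-1); split; first by rewrite invr_gt0.
move=> kappa eps phi_in phi_out k d n G h C D hk he hp d0 n1 hhk hout Gn Gdeg _.
move=> hC hDC hphi hB j hj.
apply: cluster_mixing => //.
  apply: le_trans (hC j) _; apply: le_trans hout _.
  have lnh := ln_ge_half R n1.
  have ln0 : 0 < ln n%:R :> R by lra.
  (* The index [j] forces [h], hence [k], to be positive, so the division by [k ^+ 3] only lowers
     the bound. *)
  have kk : 1 <= k%:R ^+ 3 :> R.
    by rewrite exprn_ege1 // ler1n (leq_trans _ hhk) // (leq_ltn_trans _ (ltn_ord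
      j)).
  apply: ler_wpM2l.
    by rewrite !mulr_ge0 ?exprn_ge0 ?invr_ge0 // ltW //; case/andP: hk;
      case/andP: he.
  have kl : ln n%:R <= k%:R ^+ 3 * ln n%:R :> R by apply: ler_peMl kk; apply: ltW.
  by rewrite lef_pV2 // posrE // (lt_le_trans ln0 kl).
apply: le_trans hB; rewrite ler_nat (bigD1 j) //=; exact: leq_addr.
Qed.
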